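(* Let $n>3$ be an integer and let $u_1,\dots,u_{n-3}\in(0,\infty)$. There exist $u_{n-2},u_{n-1},u_0$ such that $(u_0,u_1,\dots,u_{n-1})$ is the $u$-label of an un-branched $n$-flower if and only if $$\mathfrak C_j(u_1,\dots,u_{j-1})>0\qquad\text{for all } j=2,\dots,n-2 .$$ In this case the three remaining labels are given by $$u_{n-2}=\mathfrak U_n(u_1,\dots,u_{n-3}),\qquad u_{n-1}=\mathfrak U_n(u_2,\dots,u_{n-2}),\qquad u_0=\mathfrak U_n(u_3,\dots,u_{n-1}).$$ (In each case the arguments of $\mathfrak U_n$ are the $n-3$ consecutive labels preceding the computed one, indices taken modulo $n$; for $n=4$ these read $u_2=\mathfrak U_4(u_1)$, $u_3=\mathfrak U_4(u_2)$, $u_0=\mathfrak U_4(u_3)$.)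
   Context: **Circles.** Circles lie on the Riemann sphere $\mathbb P=\mathbb C\cup\{\infty\}$; each circle comes with a chosen interior, an open disc (possibly a half plane or a disc containing $\infty$). Two circles are (externally) tangent if they meet in exactly one point and their interiors are disjoint. Möbius transformations act on circles together with their interiors. For any two ordered triples of mutually tangent circles there is a unique Möbius transformation taking the first triple to the second in order. **Intrinsic schwarzian.** A patch $\{C_v,C_w\,|\,C_a,C_b\}$ consists of four circles such that $\{C_v,C_w,C_a\}$ and $\{C_v,C_w,C_b\}$ are mutually tangent triples. The base patch consists of the circles of radius $\sqrt3$ with $C^\Delta_v$ centered at $1-\sqrt3\,i$, $C^\Delta_w$ at $1+\sqrt3\,i$, $C^\Delta_a$ at $-2$, $C^\Delta_b$ at $4$. For a patch, let $m_f$ be the Möbius transformation taking $(C^\Delta_v,C^\Delta_w,C^\Delta_a)$ to $(C_v,C_w,C_a)$ and $m_g$ the one taking $(C^\Delta_v,C^\Delta_w,C^\Delta_b)$ to $(C_v,C_w,C_b)$. Then $m_g^{-1}\circ m_f$ is represented by a matrix $\begin{bmatrix}1+s&-s\\ s&1-s\end{bmatrix}$ for a unique real $s$, the intrinsic schwarzian of the patch (of its edge $\{C_v,C_w\}$). **Flowers.** An $n$-flower $\{C;c_0,\dots,c_{n-1}\}$ ($n\ge3$, indices mod $n$) consists of a central circle $C$ and petals $c_0,\dots,c_{n-1}$, each tangent to $C$, with $c_j$ tangent to $c_{j+1}$ for every $j$. Its label is $(s_0,\dots,s_{n-1})$, where $s_j$ is the intrinsic schwarzian of the patch $\{c_j,C\,|\,c_{j-1},c_{j+1}\}$;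 its $u$-label is $(u_0,\dots,u_{n-1})$ with $u_j=1-s_j$. Standing assumption: all $s_j<1$, i.e. all $u_j>0$. **Un-branched.** The flower is un-branched if its petals wrap exactly once around $C$: after a Möbius transformation taking the interior of $C$ to the unit disc, with $\tau_j$ the tangency point of $c_j$ and $C$, the counterclockwise arcs from $\tau_j$ to $\tau_{j+1}$, $j=0,\dots,n-1$ (each of length in $(0,2\pi)$) have total length $2\pi$. Non-consecutive petals may overlap. **The functions $\mathfrak C_j$ and $\mathfrak U_n$.** Put $\mathfrak C_2(x_1)=\sqrt3\,x_1$, $\mathfrak C_3(x_1,x_2)=3x_1x_2-1$, and for $j\ge3$ $$\mathfrak C_{j+1}(x_1,\dots,x_j)=\sqrt3\,x_j\,\mathfrak C_j(x_1,\dots,x_{j-1})-\mathfrak C_{j-1}(x_1,\dots,x_{j-2}).$$ Put $\mathfrak U_4(x_1)=\dfrac{2}{3x_1}$ and, for $n\ge5$, $$\mathfrak U_n(x_1,\dots,x_{n-3})=\frac{1+\mathfrak C_{n-3}(x_1,\dots,x_{n-4})}{\sqrt3\,\mathfrak C_{n-2}(x_1,\dots,x_{n-3})}.$$ *)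

(* Defs.v *)
From HB Require Import structures.
From mathcomp Require Import all_boot all_order all_algebra.
From mathcomp Require Import all_classical all_reals all_analysis.
From mathcomp Require Import complex ring lra.

Set Implicit Arguments.
Unset Strict Implicit.
Unset Printing Implicit Defensive.

Import Order.TTheory GRing.Theory Num.Theory.

Local Open Scope classical_set_scope.
Local Open Scope ring_scope.
Local Open Scope complex_scope.

Section Circles.
Context {R : realType}.

(* [None] is the point at infinity. *)
Definition sphere : Type := option R[i].

Definition normsq (z : R[i]) : R := complex.Re z ^+ 2 + complex.Im z ^+ 2.

(* A circle with a chosen interior is given by a Hermitian form of negative
   determinant, A |z|^2 + 2 Re (B z) + D (in homogeneous coordinates
   A |z|^2 + 2 Re (B z conj(w)) + D |w|^2): the circle is its zero locus and
   the interior is the locus where it is negative.  Thus A > 0 gives a round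
   disc, A = 0 a half plane and A < 0 a disc containing infinity.  Forms that
   differ by a positive factor give the same circle; everything below depends
   only on [circle_points] and [circle_interior]. *)
Record circle := Circle {
  coefA : R;
  coefB : R[i];
  coefD : R;
  circleP : coefA * coefD < normsq coefB }.

Definition circle_form (K : circle) (p : sphere) : R :=
  match p with
  | Some z => coefA K * normsq z + 2 * complex.Re (coefB K * z) + coefD K
  | None => coefA K
  end.

Definition circle_points (K : circle) : set sphere :=
  [set p | circle_form K p = 0].

Definition circle_interior (K : circle) : set sphere :=
  [set p | circle_form K p < 0].

Definition tangency_point (K L : circle) (p : sphere) : Prop :=
  circle_points K `&` circle_points L = [set p].

Definition tangent (K L : circle) : Prop :=
  (exists p, tangency_point K L p) /\
  circle_interior K `&` circle_interior L = set0.

Definition mutually_tangent (K L M : circle) : Prop :=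
  [/\ tangent K L, tangent L M & tangent K M].

Lemma round_circle_subproof (c : R[i]) (r : R) :
  0 < r -> 1 * (normsq c - r ^+ 2) < normsq (- conjc c).
Proof.
by case: c => a b r0; rewrite /normsq /= opprK sqrrN mul1r ltrBlDr ltrDl exprn_gt0.
Qed.

Definition round_circle (c : R[i]) (r : R) (r0 : 0 < r) : circle :=
  Circle (round_circle_subproof c r0).

Lemma round_circle_formE (c z : R[i]) (r : R) (r0 : 0 < r) :
  circle_form (round_circle c r0) (Some z) = normsq (z - c) - r ^+ 2.
Proof.
by case: z c => x y [a b]; rewrite /circle_form /= /normsq /=; ring.
Qed.

Lemma points_round_circle (c : R[i]) (r : R) (r0 : 0 < r) :
  circle_points (round_circle c r0) =
  [set p | exists2 z, p = Some z & normsq (z - c) = r ^+ 2].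
Proof.
apply/seteqP; split => [[z|] | p [z -> zc]]; rewrite /circle_points.
- by rewrite /mkset round_circle_formE => /subr0_eq zc; exists z.
- by move=> /= /eqP; rewrite oner_eq0.
- by rewrite /mkset round_circle_formE zc subrr.
Qed.

Lemma interior_round_circle (c : R[i]) (r : R) (r0 : 0 < r) :
  circle_interior (round_circle c r0) =
  [set p | exists2 z, p = Some z & normsq (z - c) < r ^+ 2].
Proof.
apply/seteqP; split => [[z|] | p [z -> zc]]; rewrite /circle_interior.
- by rewrite /mkset round_circle_formE subr_lt0 => zc; exists z.
- by move=> /=; rewrite ltr10.
- by rewrite /mkset round_circle_formE subr_lt0.
Qed.

(* A Moebius transformation is given by an invertible matrix, which is
   determined up to a nonzero scalar factor. *)
Definition mobius (m : 'M[R[i]]_2) (p : sphere) : sphere :=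
  match p with
  | Some z =>
      if m 1 0 * z + m 1 1 == 0 then None
      else Some ((m 0 0 * z + m 0 1) / (m 1 0 * z + m 1 1))
  | None => if m 1 0 == 0 then None else Some (m 0 0 / m 1 0)
  end.

Definition takes_circle (m : 'M[R[i]]_2) (K L : circle) : Prop :=
  mobius m @` circle_points K = circle_points L /\
  mobius m @` circle_interior K = circle_interior L.

Definition takes_triple (m : 'M[R[i]]_2) (K1 K2 K3 L1 L2 L3 : circle) : Prop :=
  [/\ takes_circle m K1 L1, takes_circle m K2 L2 & takes_circle m K3 L3].

Definition patch (Cv Cw Ca Cb : circle) : Prop :=
  mutually_tangent Cv Cw Ca /\ mutually_tangent Cv Cw Cb.

Lemma sqrt3_gt0 : 0 < Num.sqrt (3 : R).
Proof. by rewrite sqrtr_gt0 ltr0n. Qed.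

Definition base_v : circle := round_circle (1 -i* Num.sqrt 3) sqrt3_gt0.
Definition base_w : circle := round_circle (1 +i* Num.sqrt 3) sqrt3_gt0.
Definition base_a : circle := round_circle (- 2) sqrt3_gt0.
Definition base_b : circle := round_circle 4 sqrt3_gt0.

Definition schwarzian_mx (s : R) : 'M[R[i]]_2 :=
  \matrix_(i < 2, j < 2)
    (if i == 0 then (if j == 0 then (1 + s)%:C else (- s)%:C)
     else (if j == 0 then s%:C else (1 - s)%:C)).

(* [s] is the intrinsic schwarzian of the patch {Cv, Cw | Ca, Cb}. *)
Definition intrinsic_schwarzian (Cv Cw Ca Cb : circle) (s : R) : Prop :=
  patch Cv Cw Ca Cb /\
  exists mf mg : 'M[R[i]]_2,
    [/\ mf \in unitmx /\ takes_triple mf base_v base_w base_a Cv Cw Ca,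
        mg \in unitmx /\ takes_triple mg base_v base_w base_b Cv Cw Cb &
        exists2 k : R[i], k != 0 & invmx mg *m mf = k *: schwarzian_mx s].

(* [ordS] and [ord_pred] are successor and predecessor modulo [n]. *)
Record flower (n : nat) := Flower {
  center : circle;
  petal : 'I_n -> circle;
  flower_size : (3 <= n)%N;
  petal_center : forall j : 'I_n, tangent (petal j) center;
  petal_petal : forall j : 'I_n, tangent (petal j) (petal (ordS j)) }.

Definition is_label (n : nat) (F : flower n) (s : nat -> R) : Prop :=
  forall j : 'I_n,
    intrinsic_schwarzian (petal F j) (center F)
      (petal F (ord_pred j)) (petal F (ordS j)) (s j).

(* Labels are indexed by [nat]; only the values at 0, ..., n - 1 matter.  The
   positivity clause is the standing assumption s_j < 1. *)
Definition is_u_label (n : nat) (F : flower n) (u : nat -> R) : Prop :=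
  is_label F (fun j => 1 - u j) /\ forall j, (j < n)%N -> 0 < u j.

(* [delta j] is the length of the counterclockwise arc from [tau j] to
   [tau (ordS j)]. *)
Definition unbranched (n : nat) (F : flower n) : Prop :=
  exists (m : 'M[R[i]]_2) (t : 'I_n -> sphere) (tau : 'I_n -> R[i])
         (delta : 'I_n -> R),
    [/\ m \in unitmx /\
        mobius m @` circle_interior (center F) =
          [set p | exists2 z, p = Some z & normsq z < 1],
        forall j, tangency_point (petal F j) (center F) (t j) /\
                  mobius m (t j) = Some (tau j),
        forall j, 0 < delta j < 2 * pi /\
                  tau (ordS j) = tau j * (cos (delta j) +i* sin (delta j)) &
        \sum_(j < n) delta j = 2 * pi].

(* [frakC j x] is C_j(x_1, ..., x_(j-1)), where the argument x_i is [x i].  The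
   values at j = 0, 1 extend the recursion backwards. *)
Fixpoint frakC (j : nat) (x : nat -> R) {struct j} : R :=
  match j with
  | 0%N => 0
  | 1%N => 1
  | 2%N => Num.sqrt 3 * x 1%N
  | 3%N => 3 * x 1%N * x 2%N - 1
  | (k.+1 as i).+1 => Num.sqrt 3 * x i * frakC i x - frakC k x
  end.

(* [frakU n x] is U_n(x_1, ..., x_(n-3)), for n >= 4. *)
Definition frakU (n : nat) (x : nat -> R) : R :=
  if n == 4%N then 2 / (3 * x 1%N)
  else (1 + frakC (n - 3) x) / (Num.sqrt 3 * frakC (n - 2) x).

End Circles.

(* Main.v *)
(* Circles are Hermitian forms; minus the determinant polarizes to a Lorentzian
   product whose normalization [ip] is a Moebius invariant.  Externally tangent
   circles have [ip] = -1, and the end circles of a patch of schwarzian s have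
   [ip] = 1 - 6 (1 - s)^2.

   Circles tangent to the boundary of a fixed disc correspond to vectors of R^2
   up to sign (Ford circles), with [ip] = 1 - 2 det^2.  For an un-branched flower
   the signs can be chosen with det (w_j, w_{j+1}) = 1; then
   w_{j+1} + w_{j-1} = sqrt 3 u_j w_j, so that C_j (u_1, ..., u_{j-1}) is the
   continuant det (w_0, w_j), and wrapping once around means that w_{j+n} = - w_j
   and that w_j stays on one side of w_0 for 0 < j < n.  The formula for the
   remaining labels is det (w_k, w_{k+n-1}) = 1.  Conversely the recursion
   rebuilds the flower from the labels. *)
Require Import Defs.
From mathcomp Require Import all_boot all_order all_algebra.
From mathcomp Require Import all_classical all_reals all_analysis.
From mathcomp Require Import complex ring lra zify.
(* Again, since [poly] shadows the projections [coefB] and [coefD]. *)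
Require Import Defs.

Set Implicit Arguments.
Unset Strict Implicit.
Unset Printing Implicit Defensive.

Import Order.TTheory GRing.Theory Num.Theory.
Local Open Scope ring_scope.

(** * Homogeneous coordinates and pullback of circles *)

Section HomogeneousCoordinates.
Variable R : realType.
Implicit Types (K L : @circle R) (m : 'M[R[i]]_2) (p : @sphere R).

Lemma normsqM (x y : R[i]) : normsq (x * y) = normsq x * normsq y.
Proof. by case: x y => [a b] [c d]; rewrite /normsq /=; ring. Qed.

Lemma normsq_gt0 (x : R[i]) : (0 < normsq x) = (x != 0).
Proof.
case: x => a b; rewrite eq_complex /normsq /= negb_and lt0r paddr_eq0 ?sqr_ge0 //.
by rewrite !sqrf_eq0 addr_ge0 ?sqr_ge0 // andbT negb_and.
Qed.

Definition homx p : R[i] := if p is Some z then z else 1.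
Definition homy p : R[i] := if p is Some _ then 1 else 0.
Definition point_of (x y : R[i]) : sphere := if y == 0 then None else Some (x / y).

Lemma point_of_hom p : point_of (homx p) (homy p) = p.
Proof. by case: p => [z|]; rewrite /point_of /= ?oner_eq0 ?divr1 ?eqxx. Qed.

Lemma hom_neq0 p : (homx p != 0) || (homy p != 0).
Proof. by case: p => [z|] /=; rewrite oner_eq0 ?orbT. Qed.

Lemma point_ofZ (c x y : R[i]) : c != 0 -> point_of (c * x) (c * y) = point_of x y.
Proof.
move=> c0; rewrite /point_of mulf_eq0 (negbTE c0) /=; case: eqVneq => // y0.
by rewrite -mulf_div divff // mul1r.
Qed.

Lemma hom_point_of (x y : R[i]) : (x != 0) || (y != 0) ->
  exists2 c, c != 0 &
    x = c * homx (point_of x y) /\ y = c * homy (point_of x y).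
Proof.
rewrite /point_of; case: (eqVneq y 0) => [-> | y0 _] /=.
  by rewrite orbF => x0; exists x; rewrite // mulr1 mulr0.
by exists y; rewrite // mulr1 mulrC divfK.
Qed.

Lemma mobiusE m p :
  mobius m p = point_of (m 0 0 * homx p + m 0 1 * homy p)
                        (m 1 0 * homx p + m 1 1 * homy p).
Proof. by case: p => [z|]; rewrite /= !(mulr1, mulr0, addr0). Qed.

Lemma det2 m : \det m = m 0 0 * m 1 1 - m 0 1 * m 1 0.
Proof.
rewrite (expand_det_row _ 0) !big_ord_recl big_ord0 /cofactor !det_mx11 !mxE /=.
have -> : lift (0 : 'I_2) (0 : 'I_1) = 1 by exact: val_inj.
have -> : lift (1 : 'I_2) (0 : 'I_1) = 0 by exact: val_inj.
by rewrite addr0 mul1r expr1 mulN1r mulrN.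
Qed.

Lemma unit2_det m : m \in unitmx -> m 0 0 * m 1 1 - m 0 1 * m 1 0 != 0.
Proof. by rewrite unitmxE unitfE det2. Qed.

Lemma mulmx2_neq0 m (x y : R[i]) : m \in unitmx -> (x != 0) || (y != 0) ->
  (m 0 0 * x + m 0 1 * y != 0) || (m 1 0 * x + m 1 1 * y != 0).
Proof.
move=> /unit2_det det0; apply: contraTT.
rewrite !negb_or !negbK => /andP[/eqP e0 /eqP e1].
have ex : (m 0 0 * m 1 1 - m 0 1 * m 1 0) * x = 0.
  transitivity (m 1 1 * (m 0 0 * x + m 0 1 * y) - m 0 1 * (m 1 0 * x + m 1 1 * y)).
    by ring.
  by rewrite e0 e1 !mulr0 subrr.
have ey : (m 0 0 * m 1 1 - m 0 1 * m 1 0) * y = 0.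
  transitivity (m 0 0 * (m 1 0 * x + m 1 1 * y) - m 1 0 * (m 0 0 * x + m 0 1 * y)).
    by ring.
  by rewrite e0 e1 !mulr0 subrr.
by move/eqP: ex; move/eqP: ey; rewrite !mulf_eq0 (negbTE det0) /= => -> ->.
Qed.

Lemma mobius_point_of m (x y : R[i]) : (x != 0) || (y != 0) ->
  mobius m (point_of x y) = point_of (m 0 0 * x + m 0 1 * y) (m 1 0 * x + m 1 1 * y).
Proof.
move=> /hom_point_of[c c0 []]; move: (point_of x y) => p -> ->.
by rewrite mobiusE -(point_ofZ _ _ c0) !mulrDr !(mulrCA c).
Qed.

Lemma mobius_mul m1 m2 p : m2 \in unitmx ->
  mobius (m1 *m m2) p = mobius m1 (mobius m2 p).
Proof.
move=> u2; rewrite (mobiusE m2) mobius_point_of ?mulmx2_neq0 ?hom_neq0 //.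
rewrite mobiusE !mxE !big_ord_recl !big_ord0 !addr0.
rewrite (_ : lift ord0 ord0 = 1); last exact: val_inj.
by congr point_of; ring.
Qed.

Lemma mobius_id p : mobius 1%:M p = p.
Proof. by rewrite mobiusE !mxE /= !(mul1r, mul0r, add0r, addr0) point_of_hom. Qed.

Lemma mobiusK m : m \in unitmx -> cancel (mobius m) (mobius (invmx m)).
Proof. by move=> um p; rewrite -mobius_mul // mulVmx // mobius_id. Qed.

Lemma mobiusVK m : m \in unitmx -> cancel (mobius (invmx m)) (mobius m).
Proof.
by move=> um p; rewrite -mobius_mul ?unitmx_inv // mulmxV // mobius_id.
Qed.

Lemma mobiusZ (k : R[i]) m p : k != 0 -> mobius (k *: m) p = mobius m p.
Proof.
by move=> k0; rewrite !mobiusE !mxE -!mulrA -!mulrDr point_ofZ.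
Qed.

(** Homogenizing makes infinity an ordinary point, so that substituting a matrix into a circle form
    is a polynomial identity without case analysis. *)
Definition hform (A : R) (B : R[i]) (D : R) (x y : R[i]) : R :=
  A * normsq x + 2 * complex.Re (B * (x * conjc y)) + D * normsq y.

Lemma hformZ A B D c x y :
  hform A B D (c * x) (c * y) = normsq c * hform A B D x y.
Proof.
move: x y c B => [x x'] [y y'] [c c'] [B B'].
by rewrite /hform /normsq /=; ring.
Qed.

Lemma circle_formE K p :
  circle_form K p = hform (coefA K) (coefB K) (coefD K) (homx p) (homy p).
Proof.
by case: K p => A [B B'] D ? [[z z']|]; rewrite /circle_form /hform /normsq /=; ring.
Qed.

(* The off-diagonal entry of m^* H m, for H the Hermitian matrix of (A, B, D)
   and m with rows (a, b) and (c, d). *)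
Definition pullB (A : R) (B : R[i]) (D : R) (a b c d : R[i]) : R[i] :=
  A%:C%C * (a * conjc b) + B * (a * conjc d)
  + conjc B * (c * conjc b) + D%:C%C * (c * conjc d).

Lemma hform_lin A B D a b c d x y :
  hform A B D (a * x + b * y) (c * x + d * y) =
  hform (hform A B D a c) (pullB A B D a b c d) (hform A B D b d) x y.
Proof.
move: a b c d x y B => [a a'] [b b'] [c c'] [d d'] [x x'] [y y'] [B B'].
by rewrite /hform /pullB /normsq /=; ring.
Qed.

(* The Lorentzian inner product of circles, polarizing minus the determinant
   of the Hermitian form. *)
Definition lorentz (A : R) (B : R[i]) (D A1 : R) (B1 : R[i]) (D1 : R) : R :=
  complex.Re (B * conjc B1) - (A * D1 + A1 * D) / 2.

(** The polarization of det (m^* H m) = |det m|^2 det H. This makes the normalized product a Moebius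
    invariant. *)
Lemma lorentz_lin A B D A1 B1 D1 a b c d :
  lorentz (hform A B D a c) (pullB A B D a b c d) (hform A B D b d)
    (hform A1 B1 D1 a c) (pullB A1 B1 D1 a b c d) (hform A1 B1 D1 b d) =
  normsq (a * d - b * c) * lorentz A B D A1 B1 D1.
Proof.
move: a b c d B B1 => [a a'] [b b'] [c c'] [d d'] [B B'] [B1 B1'].
by rewrite /lorentz /hform /pullB /normsq /=; field.
Qed.

Lemma lorentz_diag A B D : lorentz A B D A B D = normsq B - A * D.
Proof. by case: B => a b; rewrite /lorentz /normsq /=; field. Qed.

Definition circle_prod K L : R :=
  lorentz (coefA K) (coefB K) (coefD K) (coefA L) (coefB L) (coefD L).

Lemma circle_prod_gt0 K : 0 < circle_prod K K.
Proof. by rewrite /circle_prod lorentz_diag subr_gt0 circleP. Qed.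

Lemma pull_subproof m K : m \in unitmx ->
  hform (coefA K) (coefB K) (coefD K) (m 0 0) (m 1 0) *
  hform (coefA K) (coefB K) (coefD K) (m 0 1) (m 1 1) <
  normsq (pullB (coefA K) (coefB K) (coefD K) (m 0 0) (m 0 1) (m 1 0) (m 1 1)).
Proof.
move=> /unit2_det det0; rewrite -subr_gt0 -lorentz_diag lorentz_lin mulr_gt0 //.
  by rewrite normsq_gt0.
exact: circle_prod_gt0.
Qed.

(** The preimage of [K] under [m]. Working with preimages keeps matrix inverses out of the
    coefficients. *)
Definition pull m (um : m \in unitmx) K : circle := Circle (pull_subproof K um).

(** The factor comes from rescaling homogeneous coordinates. It is a squared modulus, hence
    positive, so both the zero locus and the interior are pulled back. *)
Lemma circle_form_pull m (um : m \in unitmx) K p :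
  exists2 c, 0 < c & circle_form (pull um K) p = c * circle_form K (mobius m p).
Proof.
have [c c0 [ex ey]] := hom_point_of (mulmx2_neq0 um (hom_neq0 p)).
rewrite -mobiusE in ex ey.
exists (normsq c); first by rewrite normsq_gt0.
by rewrite circle_formE /= -hform_lin ex ey hformZ -circle_formE.
Qed.

Lemma points_pull m (um : m \in unitmx) K p :
  circle_points (pull um K) p <-> circle_points K (mobius m p).
Proof.
rewrite /circle_points /=; have [c c0 ->] := circle_form_pull um K p.
split=> [/eqP | ->]; last by rewrite mulr0.
by rewrite mulf_eq0 gt_eqF //= => /eqP.
Qed.

Lemma interior_pull m (um : m \in unitmx) K p :
  circle_interior (pull um K) p <-> circle_interior K (mobius m p).
Proof.
rewrite /circle_interior /=; have [c c0 ->] := circle_form_pull um K p.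
by rewrite pmulr_rlt0.
Qed.

Definition same_circle K L : Prop :=
  forall p, (circle_points K p <-> circle_points L p) /\
            (circle_interior K p <-> circle_interior L p).

Definition proportional K L : Prop :=
  exists2 c, 0 < c &
    [/\ coefA L = c * coefA K, coefB L = c%:C%C * coefB K & coefD L = c * coefD K].

Lemma proportional_same K L : proportional K L -> same_circle K L.
Proof.
move=> [c c0 [eA eB eD]] p.
have e : circle_form L p = c * circle_form K p.
  rewrite !circle_formE eA eB eD /hform.
  move: (homx p) (homy p) (coefB K) => [x x'] [y y'] [B B'].
  by rewrite /normsq /=; ring.
rewrite /circle_points /circle_interior /= e pmulr_rlt0 //; split=> //.
by split=> [-> | /eqP]; rewrite ?mulr0 // mulf_eq0 gt_eqF //= => /eqP.
Qed.

Lemma takes_circleP m (um : m \in unitmx) K L :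
  takes_circle m K L <-> same_circle K (pull um L).
Proof.
split=> [[eP eI] p | H].
  split; rewrite ?points_pull ?interior_pull -?eP -?eI /=; split.
  - by move=> Kp; exists p.
  - by move=> [q Kq] /(can_inj (mobiusK um)) <-.
  - by move=> Kp; exists p.
  - by move=> [q Kq] /(can_inj (mobiusK um)) <-.
split; apply/seteqP; split=> q.
- by move=> [p Kp <-]; apply/points_pull; apply/(H p).1.
- move=> Lq; exists (mobius (invmx m) q); rewrite ?mobiusVK //.
  by apply/(H _).1/points_pull; rewrite mobiusVK.
- by move=> [p Kp <-]; apply/interior_pull; apply/(H p).2.
- move=> Lq; exists (mobius (invmx m) q); rewrite ?mobiusVK //.
  by apply/(H _).2/interior_pull; rewrite mobiusVK.
Qed.

End HomogeneousCoordinates.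

(** * The inversive product *)

Section InversiveProduct.
Variable R : realType.
Implicit Types (K L : @circle R) (m : 'M[R[i]]_2) (p : @sphere R).

Lemma same_circle_sym K L : same_circle K L -> same_circle L K.
Proof. by move=> H p; have [h1 h2] := H p; split; apply: iff_sym. Qed.

Lemma same_circle_trans K L M : same_circle K L -> same_circle L M -> same_circle K M.
Proof.
move=> H G p; have [h1 h2] := H p; have [g1 g2] := G p.
by split; [apply: iff_trans g1 | apply: iff_trans g2].
Qed.

(** Finitely many test points on the first circle determine the second form up to a factor, and one
    interior point fixes the sign of that factor. This makes [ip] a function of the circle rather
    than of the chosen form. *)
Lemma same_proportional K L : same_circle K L -> proportional K L.
Proof.
case: K L => A [b b'] D KP [A1 [b1 b1'] D1 LP] H.
have pt x y : A * (x ^+ 2 + y ^+ 2) + 2 * (b * x - b' * y) + D = 0 ->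
    A1 * (x ^+ 2 + y ^+ 2) + 2 * (b1 * x - b1' * y) + D1 = 0.
  by move=> e; have := (H (Some (x +i* y)%C)).1.1 e.
have int x y : A * (x ^+ 2 + y ^+ 2) + 2 * (b * x - b' * y) + D < 0 ->
    A1 * (x ^+ 2 + y ^+ 2) + 2 * (b1 * x - b1' * y) + D1 < 0.
  by move=> e; have := (H (Some (x +i* y)%C)).2.1 e.
have pt0 : A = 0 -> A1 = 0 by exact: (H None).1.1.
have int0 : A < 0 -> A1 < 0 by exact: (H None).2.1.
have {H} N0 := KP; rewrite /normsq /= in N0.
rewrite /proportional /=.
case: (eqVneq A 0) => [A0 | A0].
  have A10 := pt0 A0; move: pt int N0 {pt0 int0}; rewrite A0 A10 !mul0r => pt int N0.
  set n := b ^+ 2 + b' ^+ 2 in N0.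
  have n0 : n != 0 by rewrite gt_eqF.
  (* The test points on the line are the foot of the perpendicular from the origin and its translate
     by the direction (b', b) of the line. *)
  have e0 : 2 * (b1 * (- D / (2 * n) * b) - b1' * (D / (2 * n) * b')) + D1 = 0.
    have := pt (- D / (2 * n) * b) (D / (2 * n) * b').
    rewrite !mul0r !add0r; apply; rewrite /n in n0 *; field; exact: n0.
  have e1 : 2 * (b1 * (- D / (2 * n) * b + b') - b1' * (D / (2 * n) * b' + b)) + D1 = 0.
    have := pt (- D / (2 * n) * b + b') (D / (2 * n) * b' + b).
    rewrite !mul0r !add0r; apply; rewrite /n in n0 *; field; exact: n0.
  have e2 : b1 * b' = b1' * b by lra.
  have kb : b1 = (b1 * b + b1' * b') / n * b.
    apply: (mulIf n0); rewrite mulrAC divfK // /n.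
    by rewrite mulrDl mulrAC -[b1' * b' * b]mulrAC -e2; ring.
  have kb' : b1' = (b1 * b + b1' * b') / n * b'.
    apply: (mulIf n0); rewrite mulrAC divfK // /n.
    by rewrite mulrDl -[b1 * b * b']mulrAC e2; ring.
  have kD : D1 = (b1 * b + b1' * b') / n * D.
    by move/eqP: e0; rewrite addrC addr_eq0 => /eqP ->; field.
  move: (_ / n) kb kb' kD => k kb kb' kD; exists k; last first.
    split=> //; first by rewrite mulr0.
    by apply/eqP; rewrite eq_complex /= !mul0r subr0 addr0 -kb -kb' !eqxx.
  have kX x y : 2 * (b1 * x - b1' * y) + D1 = k * (2 * (b * x - b' * y) + D).
    by rewrite kb kb' kD; ring.
  (* Moving from the foot against the gradient (2 b, - 2 b') reaches the interior, which gives
     [0 < k]. *)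
  have := int (- D / (2 * n) * b - b) (D / (2 * n) * b' + b').
  rewrite !mul0r !add0r kX => int'.
  have eq0 : 2 * (b * (- D / (2 * n) * b - b) - b' * (D / (2 * n) * b' + b')) + D = - 2 * n.
    by rewrite /n in n0 *; field; exact: n0.
  have n_lt0 : - 2 * n < 0 by lra.
  by rewrite eq0 in int'; have := int' n_lt0; rewrite (nmulr_llt0 _ n_lt0).
set N := b ^+ 2 + b' ^+ 2 - A * D.
have Npos : 0 < N by rewrite subr_gt0.
have [s s0 ss] : exists2 s, s != 0 & s ^+ 2 = N.
  by exists (Num.sqrt N); rewrite ?sqr_sqrtr ?ltW // sqrtr_eq0 -ltNge.
have onK x y : (A * x + b) ^+ 2 + (A * y - b') ^+ 2 = N ->
    A1 * (x ^+ 2 + y ^+ 2) + 2 * (b1 * x - b1' * y) + D1 = 0.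
  move=> e; apply: pt; apply: (mulfI A0); rewrite mulr0 -[RHS](subrr N) -{1}e /N.
  by ring.
pose f x y := A1 * (x ^+ 2 + y ^+ 2) + 2 * (b1 * x - b1' * y) + D1.
(* The four horizontal and vertical extremes of a circle with centre (- b / A, b' / A) and radius s
   / |A|; comparing opposite ones isolates [b1] and [b1']. *)
have e1 := onK ((- b + s) / A) (b' / A).
have e2 := onK ((- b - s) / A) (b' / A).
have e3 := onK (- b / A) ((b' + s) / A).
have e4 := onK (- b / A) ((b' - s) / A).
rewrite ![A * (_ / A)]mulrCA !divff // !mulr1 in e1 e2 e3 e4.
have {}e1 : _ := e1 ltac:(rewrite -ss; ring).
have {}e2 : _ := e2 ltac:(rewrite -ss; ring).
have {}e3 : _ := e3 ltac:(rewrite -ss; ring).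
have {}e4 : _ := e4 ltac:(rewrite -ss; ring).
have kb : b1 = A1 / A * b.
  apply: (mulIf s0); apply: (mulfI A0); apply/eqP; rewrite -subr_eq0; apply/eqP.
  transitivity (A ^+ 2 / 4 * (f ((- b + s) / A) (b' / A) - f ((- b - s) / A) (b' / A))).
    by rewrite /f; field.
  by rewrite /f e1 e2 subrr mulr0.
have kb' : b1' = A1 / A * b'.
  apply: (mulIf s0); apply: (mulfI A0); apply/eqP; rewrite -subr_eq0; apply/eqP.
  transitivity (A ^+ 2 / 4 * (f (- b / A) ((b' - s) / A) - f (- b / A) ((b' + s) / A))).
    by rewrite /f; field.
  by rewrite /f e3 e4 subrr mulr0.
have kD : D1 = A1 / A * D.
  move/eqP: e1; rewrite addrC addr_eq0 => /eqP ->; rewrite kb kb'.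
  have -> : D = (b ^+ 2 + b' ^+ 2 - s ^+ 2) / A by rewrite ss /N; field.
  by field.
have kA : A1 = A1 / A * A by rewrite divfK.
move: (A1 / A) kb kb' kD kA => k kb kb' kD kA; exists k; last first.
  split=> //.
  by apply/eqP; rewrite eq_complex /= !mul0r subr0 addr0 -kb -kb' !eqxx.
(* The interior point that fixes the sign is infinity if A < 0 and the centre if A > 0. *)
case: (ltrgtP A 0) => [An | Ap | /eqP]; last by rewrite (negbTE A0).
  by have := int0 An; rewrite kA nmulr_llt0.
have := int (- b / A) (b' / A); rewrite kA kb kb' kD.
set X := A * _ + _ + _; have XE : X = - N / A by rewrite /X /N; field.
have Xn : X < 0 by rewrite XE mulNr oppr_lt0 divr_gt0.
move/(_ Xn); rewrite [X in X < 0](_ : _ = k * X); last by rewrite /X; ring.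
by rewrite (nmulr_llt0 _ Xn).
Qed.

Definition ip K L : R :=
  circle_prod K L / Num.sqrt (circle_prod K K * circle_prod L L).

Lemma ip_same K K' L L' : same_circle K K' -> same_circle L L' -> ip K L = ip K' L'.
Proof.
move=> /same_proportional[c c0 [eA eB eD]] /same_proportional[d d0 [fA fB fD]].
rewrite /ip.
have e2 : circle_prod K' K' * circle_prod L' L' =
    (c * d) ^+ 2 * (circle_prod K K * circle_prod L L).
  rewrite /circle_prod !lorentz_diag eA eB eD fA fB fD !normsqM.
  by rewrite /(normsq c%:C%C) /(normsq d%:C%C) /=; ring.
have e1 : circle_prod K' L' = c * d * circle_prod K L.
  rewrite /circle_prod eA eB eD fA fB fD /lorentz.
  by move: (coefB K) (coefB L) => [b b'] [b1 b1'] /=; ring.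
have cd : 0 < c * d by rewrite mulr_gt0.
rewrite e1 e2 [in RHS]sqrtrM ?sqr_ge0 // sqrtr_sqr gtr0_norm // -mulf_div divff ?mul1r //.
by rewrite gt_eqF.
Qed.

Lemma ip_pull m (um : m \in unitmx) K L : ip (pull um K) (pull um L) = ip K L.
Proof.
rewrite /ip.
have e M N : circle_prod (pull um M) (pull um N) =
    normsq (m 0 0 * m 1 1 - m 0 1 * m 1 0) * circle_prod M N by exact: lorentz_lin.
rewrite !e; set c := normsq _.
have c0 : 0 < c by rewrite normsq_gt0 unit2_det.
rewrite mulrACA -expr2 sqrtrM ?sqr_ge0 // sqrtr_sqr gtr0_norm //.
by rewrite -mulf_div divff ?mul1r // gt_eqF.
Qed.

Lemma tangent_sym K L : tangent K L -> tangent L K.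
Proof. by move=> [[p e] i]; split; [exists p|]; rewrite ?/tangency_point setIC. Qed.

Lemma tangent_same K K' L L' : same_circle K K' -> same_circle L L' ->
  tangent K L -> tangent K' L'.
Proof.
move=> HK HL.
have eK : circle_points K = circle_points K' by apply/seteqP; split=> p /(HK p).1.
have eL : circle_points L = circle_points L' by apply/seteqP; split=> p /(HL p).1.
have iK : circle_interior K = circle_interior K' by apply/seteqP; split=> p /(HK p).2.
have iL : circle_interior L = circle_interior L' by apply/seteqP; split=> p /(HL p).2.
by rewrite /tangent /tangency_point eK eL iK iL.
Qed.

Lemma tangency_point_pull m (um : m \in unitmx) K L p :
  tangency_point K L (mobius m p) -> tangency_point (pull um K) (pull um L) p.
Proof.
rewrite /tangency_point => e; apply/seteqP; split=> q.
  move=> [/points_pull Kq /points_pull Lq].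
  have : [set mobius m p]%classic (mobius m q) by rewrite -e.
  by move/(can_inj (mobiusK um)).
move=> ->; have : [set mobius m p]%classic (mobius m p) by [].
by rewrite -e => -[Kp Lp]; split; apply/points_pull.
Qed.

Lemma tangent_pull m (um : m \in unitmx) K L :
  tangent K L -> tangent (pull um K) (pull um L).
Proof.
move=> [[p e] i]; split.
  exists (mobius (invmx m) p); apply: tangency_point_pull.
  by rewrite mobiusVK.
rewrite -subset0 => q [/interior_pull Kq /interior_pull Lq].
by have : set0 (mobius m q) by rewrite -i.
Qed.

Lemma takes_tangent m (um : m \in unitmx) K L K' L' :
  takes_circle m K K' -> takes_circle m L L' -> tangent K' L' -> tangent K L.
Proof.
move=> /(takes_circleP um)/same_circle_sym HK /(takes_circleP um)/same_circle_sym HL.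
by move/(tangent_pull um); apply: tangent_same.
Qed.

Lemma moves_infinity p : exists2 m : 'M[R[i]]_2, m \in unitmx & mobius m None = p.
Proof.
case: p => [z|]; last by exists 1%:M; rewrite ?unitmx1 ?mobius_id.
exists (\matrix_(i < 2, j < 2) (if i == 0 then (if j == 0 then z else -1)
                               else (if j == 0 then 1 else 0))).
  by rewrite unitmxE unitfE det2 !mxE /= mulr0 mulN1r sub0r opprK oner_eq0.
by rewrite /mobius !mxE /= oner_eq0 divr1.
Qed.


End InversiveProduct.

(** * Tangency and schwarzians in terms of the inversive product *)

Section TangentCircles.
Variable R : realType.
Implicit Types (K L : @circle R) (m : 'M[R[i]]_2) (p : @sphere R).

(** Circles through infinity are lines. Meeting nowhere else makes them parallel, and disjoint half
    planes then have opposite normals. *)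
Lemma tangent_at_infinity_ip K L : tangency_point K L None ->
  (circle_interior K `&` circle_interior L = set0)%classic -> ip K L = -1.
Proof.
case: K L => A [b b'] D KP [A1 [b1 b1'] D1 LP]; rewrite /tangency_point => e i.
have [A0 A10] : (circle_points (Circle KP) `&` circle_points (Circle LP))%classic None.
  by rewrite e.
rewrite /circle_points /mkset /= in A0 A10.
have pts x y : 2 * (b * x - b' * y) + D = 0 -> 2 * (b1 * x - b1' * y) + D1 = 0 -> False.
  move=> h h1.
  suff : (circle_points (Circle KP) `&` circle_points (Circle LP))%classic
      (Some (x +i* y)%C) by rewrite e.
  by split; rewrite /circle_points /mkset /circle_form /= ?A0 ?A10 mul0r add0r.
have int x y : 2 * (b * x - b' * y) + D < 0 -> 2 * (b1 * x - b1' * y) + D1 < 0 -> False.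
  move=> h h1.
  suff : (circle_interior (Circle KP) `&` circle_interior (Circle LP))%classic
      (Some (x +i* y)%C) by rewrite i.
  by split; rewrite /circle_interior /mkset /circle_form /= ?A0 ?A10 mul0r add0r.
have N0 := KP; have N1 := LP.
rewrite /ip /circle_prod !lorentz_diag /lorentz /=.
rewrite /normsq /= A0 A10 !mul0r in N0 N1 *; rewrite !subr0 addr0 mul0r subr0 mulrN opprK.
(* Otherwise Cramer's rule gives a finite common point. *)
have par : b * b1' = b1 * b'.
  apply/eqP; rewrite -subr_eq0; apply/negP => /negP d0.
  apply: (pts ((D1 * b' - D * b1') / (2 * (b * b1' - b1 * b')))
              ((D1 * b - D * b1) / (2 * (b * b1' - b1 * b')))); by field.
set q := b * b1 + b' * b1'.
have q2 : (b ^+ 2 + b' ^+ 2) * (b1 ^+ 2 + b1' ^+ 2) = q ^+ 2.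
  transitivity (q ^+ 2 + (b * b1' - b1 * b') ^+ 2); first by rewrite /q; ring.
  by rewrite par subrr expr0n addr0.
have q0 : q < 0.
  rewrite ltNge; apply/negP => qge.
  have {qge} qp : 0 < q.
    by rewrite lt_neqAle qge andbT eq_sym -sqrf_eq0 -q2 gt_eqF // mulr_gt0.
  (* With normals in the same direction, a point far enough along that direction lies in both half
     planes; [t] is large enough to outweigh both [D] and [D1]. *)
  pose t := `|D| / (b ^+ 2 + b' ^+ 2) + `|D1| / q + 1.
  have t1 : 2 * t * (b ^+ 2 + b' ^+ 2) > D.
    have tge : `|D| / (b ^+ 2 + b' ^+ 2) + 1 <= t.
      by rewrite /t addrAC lerDl divr_ge0 // ltW.
    have : (`|D| / (b ^+ 2 + b' ^+ 2) + 1) * (b ^+ 2 + b' ^+ 2) <= t * (b ^+ 2 + b' ^+ 2).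
      by rewrite ler_pM2r.
    rewrite mulrDl divfK ?gt_eqF // mul1r; have := ler_norm D; have := normr_ge0 D; lra.
  have t2 : 2 * t * q > D1.
    have tge : `|D1| / q + 1 <= t.
      by rewrite /t -addrA lerDr divr_ge0 // ltW.
    have : (`|D1| / q + 1) * q <= t * q by rewrite ler_pM2r.
    rewrite mulrDl divfK ?gt_eqF // mul1r; have := ler_norm D1; have := normr_ge0 D1; lra.
  apply: (int (- t * b) (t * b')).
    rewrite [X in X < 0](_ : _ = D - 2 * t * (b ^+ 2 + b' ^+ 2)); last by ring.
    by rewrite subr_lt0.
  rewrite [X in X < 0](_ : _ = D1 - 2 * t * q); last by rewrite /q; ring.
  by rewrite subr_lt0.
rewrite q2 sqrtr_sqr ltr0_norm // invrN mulrN divff // lt_eqF //.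
Qed.

(** By invariance of [ip], the tangency point may be moved to infinity. *)
Lemma tangent_ip K L : tangent K L -> ip K L = -1.
Proof.
move=> [[p e] i]; have [m um mp] := moves_infinity p; rewrite -mp in e.
rewrite -(ip_pull um); apply: tangent_at_infinity_ip.
  exact: tangency_point_pull.
by have [] := tangent_pull um (conj (ex_intro _ _ e) i).
Qed.

Lemma pull_mul_same m1 m2 (u1 : m1 \in unitmx) (u2 : m2 \in unitmx)
    (u12 : m1 *m m2 \in unitmx) K :
  same_circle (pull u12 K) (pull u2 (pull u1 K)).
Proof.
by move=> p; rewrite !points_pull !interior_pull mobius_mul.
Qed.

Lemma pull_same m (um : m \in unitmx) K L :
  same_circle K L -> same_circle (pull um K) (pull um L).
Proof.
by move=> H p; rewrite !points_pull !interior_pull; apply: H.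
Qed.

Lemma det_schwarzian (s : R) : \det (schwarzian_mx s) = 1.
Proof.
rewrite det2 !mxE /=; apply/eqP; rewrite eq_complex /=.
by apply/andP; split; apply/eqP; ring.
Qed.

Lemma base_schwarzian_ip (s : R) (us : schwarzian_mx s \in unitmx) :
  ip base_a (pull us base_b) = 1 - 6 * (1 - s) ^+ 2.
Proof.
have N1 : circle_prod (@base_a R) base_a = 3.
  rewrite /circle_prod lorentz_diag /base_a /= /normsq /= sqr_sqrtr ?ler0n //; ring.
have N2 : circle_prod (pull us base_b) (pull us base_b) = 3.
  transitivity (circle_prod (@base_b R) base_b).
    rewrite {1}/circle_prod lorentz_lin -[X in normsq X]/(_ - _) -det2 det_schwarzian.
    by rewrite /normsq /= expr1n expr0n addr0 mul1r.
  rewrite /circle_prod lorentz_diag /base_b /= /normsq /= sqr_sqrtr ?ler0n //; ring.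
rewrite /ip N1 N2 -expr2 sqrtr_sqr ger0_norm ?ler0n //.
rewrite /circle_prod /= !mxE /= /lorentz /hform /pullB /normsq /= sqr_sqrtr ?ler0n //.
by field.
Qed.

(** Pulling back along [mf], which is [mg *m schwarzian_mx s] up to a scalar, turns [Ca] into
    [base_a] and [Cb] into the pullback of [base_b] by the schwarzian matrix. The product of these
    two is an explicit computation. *)
Lemma intrinsic_schwarzian_ip Cv Cw Ca Cb (s : R) :
  intrinsic_schwarzian Cv Cw Ca Cb s -> ip Ca Cb = 1 - 6 * (1 - s) ^+ 2.
Proof.
move=> [_ [mf [mg [[uf [_ _ ta]] [ug [_ _ tb]] [k k0 e]]]]].
have us : schwarzian_mx s \in unitmx by rewrite unitmxE det_schwarzian unitr1.
have mfE : mf = k *: (mg *m schwarzian_mx s).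
  by rewrite scalemxAr -e mulmxA mulmxV // mul1mx.
have ums : mg *m schwarzian_mx s \in unitmx by rewrite unitmx_mul ug us.
move/(takes_circleP uf): ta => ta; move/(takes_circleP ug): tb => tb.
have sa : same_circle base_a (pull us (pull ug Ca)).
  apply: same_circle_trans ta _; apply: same_circle_trans (pull_mul_same ug us ums Ca).
  by move=> p; rewrite !points_pull !interior_pull mfE mobiusZ.
rewrite -(ip_pull ug) -(ip_pull us) -(ip_same sa (pull_same us tb)).
exact: base_schwarzian_ip.
Qed.

End TangentCircles.

(** * Unbranched flowers around the unit disc *)

Section UnitDisc.
Variable R : realType.
Implicit Types (K L U : @circle R) (m : 'M[R[i]]_2) (p : @sphere R).

Definition is_unit_disc U : Prop :=
  exists2 a, 0 < a & [/\ coefA U = a, coefB U = 0 & coefD U = - a].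

(** The form is negative inside the disc and nonnegative outside, so it vanishes on the unit circle;
    its values at 1, -1, i and -i then give the coefficients. *)
Lemma interior_unit_disc U :
  circle_interior U = [set p | exists2 z, p = Some z & normsq z < 1]%classic ->
  is_unit_disc U.
Proof.
case: U => A [b b'] D UP e.
have inside x y : x ^+ 2 + y ^+ 2 < 1 ->
    A * (x ^+ 2 + y ^+ 2) + 2 * (b * x - b' * y) + D < 0.
  move=> h; have : circle_interior (Circle UP) (Some (x +i* y)%C).
    by rewrite e; exists (x +i* y)%C.
  by [].
have outside x y : 1 <= x ^+ 2 + y ^+ 2 ->
    0 <= A * (x ^+ 2 + y ^+ 2) + 2 * (b * x - b' * y) + D.
  move=> h; rewrite leNgt; apply/negP => h'.
  have : circle_interior (Circle UP) (Some (x +i* y)%C) by [].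
  by rewrite e => -[z [<-]]; rewrite /normsq /= ltNge h.
have A0 : 0 <= A.
  rewrite leNgt; apply/negP => h'.
  have : circle_interior (Circle UP) None by [].
  by rewrite e => -[z].
have on x y : x ^+ 2 + y ^+ 2 = 1 -> A + 2 * (b * x - b' * y) + D = 0.
  move=> h; set q := 2 * (b * x - b' * y).
  have qt t : t ^+ 2 < 1 -> A * t ^+ 2 + q * t + D < 0.
    move=> t1; have := inside (t * x) (t * y); rewrite !exprMn -mulrDr h mulr1.
    move=> /(_ t1); rewrite [X in X < 0 -> _](_ : _ = A * t ^+ 2 + q * t + D) //.
    by rewrite /q; ring.
  have q1 : 0 <= A + q + D.
    by have := outside x y; rewrite h mulr1 lexx; apply.
  apply/eqP; rewrite eq_le q1 andbT leNgt; apply/negP => q2.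
  have q3 : D < 0 by have := qt 0; rewrite expr0n /= ltr01 !mulr0 !add0r; apply.
  have M0 : 0 < 2 * A + q by lra.
  (* A Newton step from t = 1 replaces a continuity argument: along the ray the form is a convex
     quadratic in t, so it is still nonnegative at t = 1 - s, which lies inside the disc. *)
  set s := (A + q + D) / (2 * A + q).
  have s0 : 0 < s by rewrite divr_gt0.
  have s1 : s <= 1 by rewrite ler_pdivrMr // mul1r; lra.
  have sE : (2 * A + q) * s = A + q + D by rewrite mulrC divfK ?gt_eqF.
  have : (1 - s) ^+ 2 < 1.
    have -> : (1 - s) ^+ 2 = 1 - s * (2 - s) by ring.
    by have : 0 < s * (2 - s); [rewrite mulr_gt0 //; lra | lra].
  move/qt; rewrite [X in X < 0](_ : _ = A * s ^+ 2 + (A + q + D - (2 * A + q) * s)); last by ring.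
  by rewrite sE subrr addr0 ltNge mulr_ge0 ?sqr_ge0.
have e1 := on 1 0; have e2 := on (-1) 0; have e3 := on 0 1; have e4 := on 0 (-1).
rewrite !(expr0n, expr1n, sqrrN, mulr0, mulr1, subr0, addr0, add0r, sub0r, mulrN1,
  opprK) /= in e1 e2 e3 e4.
have {}e1 := e1 erefl; have {}e2 := e2 erefl.
have {}e3 := e3 erefl; have {}e4 := e4 erefl.
have := inside 0 0; rewrite !(expr0n, mulr0, subr0, addr0, add0r) ltr01 /= => /(_ isT) D0.
have b0 : b = 0 by lra.
have b'0 : b' = 0 by lra.
exists A; first by lra.
by split=> //=; [rewrite b0 b'0 | lra].
Qed.

(** The petal touching the unit disc at [z]: [h - 1] is its signed curvature (a half plane at h = 1,
    a disc containing infinity for h < 1), and [nu] is the free positive scale of the form. *)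
Definition disc_petal (h : R) (z : R[i]) K : Prop :=
  [/\ 0 < h, normsq z = 1 & exists2 nu, 0 < nu &
    [/\ coefA K = nu * (h - 1), coefB K = - (nu * h)%:C%C * conjc z &
        coefD K = nu * (h + 1)]].

Lemma tangent_unit_disc K U z : is_unit_disc U -> tangent K U ->
  tangency_point K U (Some z) -> exists h, disc_petal h z K.
Proof.
case: K U z => A [b b'] D KP [a [B0 B0'] D0] UP [x y] [c c0 [/= aE [B00 B0'0] D0E]].
move: UP c0; rewrite -aE in D0E *; rewrite {}B00 {}B0'0 {}D0E => UP a0 T e.
have := tangent_ip T; rewrite /ip /circle_prod !lorentz_diag /lorentz /=.
have [] : (circle_points (Circle KP) `&` circle_points (Circle UP))%classic
    (Some (x +i* y)%C) by rewrite e.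
rewrite /circle_points /mkset /circle_form /normsq /= => Kz Uz.
rewrite oppr0 !mulr0 subrr add0r expr0n /= addr0.
set N := b ^+ 2 + b' ^+ 2 - A * D.
have Npos : 0 < N by rewrite subr_gt0.
have z1 : x ^+ 2 + y ^+ 2 = 1.
  by apply: (mulfI (lt0r_neq0 a0)); move: Uz; rewrite !mul0r; lra.
have -> : 0 - a * - a = a ^+ 2 by ring.
rewrite sqrtrM ?(ltW Npos) // sqrtr_sqr gtr0_norm //.
set nu := Num.sqrt N.
have nu0 : 0 < nu by rewrite sqrtr_gt0.
have nuE : nu ^+ 2 = N by rewrite sqr_sqrtr ?ltW.
move=> ipE.
(* This is [ip] = -1 with the denominator [nu * a] cleared. *)
have ADnu : D - A = 2 * nu.
  apply: (mulfI (lt0r_neq0 a0)).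
  have nua : nu * a != 0 by rewrite mulf_neq0 ?gt_eqF.
  by have /= := congr1 (fun t => t * (nu * a)) ipE; rewrite divfK //; lra.
set h := (A + D) / (2 * nu).
have hE : nu * h = (A + D) / 2 by rewrite /h; field; rewrite gt_eqF.
have AE : A = nu * (h - 1) by rewrite mulrBr hE mulr1; lra.
have DE : D = nu * (h + 1) by rewrite mulrDr hE mulr1; lra.
have B2 : b ^+ 2 + b' ^+ 2 = (nu * h) ^+ 2.
  have -> : b ^+ 2 + b' ^+ 2 = N + A * D by rewrite /N; ring.
  by rewrite -nuE AE DE; ring.
(* Incidence at z gives Re (B z) = - nu h. Since |B| = nu |h| and |z| = 1, the imaginary part of B z
   vanishes, which determines B. *)
have e1 : b * x - b' * y = - (nu * h) by rewrite z1 in Kz; lra.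
have e2 : b * y + b' * x = 0.
  apply/eqP; rewrite -sqrf_eq0; apply/eqP.
  transitivity ((b ^+ 2 + b' ^+ 2) * (x ^+ 2 + y ^+ 2) - (b * x - b' * y) ^+ 2).
    by ring.
  by rewrite e1 B2 z1; ring.
have bE : b = - (nu * h) * x.
  transitivity (b * (x ^+ 2 + y ^+ 2)); first by rewrite z1 mulr1.
  transitivity ((b * x - b' * y) * x + (b * y + b' * x) * y); first by ring.
  by rewrite e1 e2 mul0r addr0.
have b'E : b' = (nu * h) * y.
  transitivity (b' * (x ^+ 2 + y ^+ 2)); first by rewrite z1 mulr1.
  transitivity (- (b * x - b' * y) * y + (b * y + b' * x) * x); first by ring.
  by rewrite e1 e2 mul0r addr0 opprK.
exists h; split=> //; last first.
  exists nu => //; split=> //=; apply/eqP; rewrite eq_complex /= bE b'E.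
  by apply/andP; split; apply/eqP; ring.
have formE t : A * ((- t * x) ^+ 2 + (- t * y) ^+ 2) + 2 * (b * (- t * x) - b' * (- t * y)) + D
    = nu * ((1 + t) * (h * (1 + t) + 1 - t)).
  transitivity (A * t ^+ 2 * (x ^+ 2 + y ^+ 2) - 2 * t * (b * x - b' * y) + D); first by ring.
  by rewrite z1 e1 AE DE; ring.
have discE t : a * ((- t * x) ^+ 2 + (- t * y) ^+ 2) + 2 * (0 * (- t * x) - 0 * (- t * y)) - a
    = a * (t ^+ 2 - 1).
  transitivity (a * (t ^+ 2 * (x ^+ 2 + y ^+ 2) - 1)); first by ring.
  by rewrite z1 mulr1.
(* If h = 0, the antipode of z is a second common point; if h < 0, a point - t z with t < 1 close to
   1 lies in both interiors. *)
rewrite ltNge; apply/negP; rewrite le_eqVlt => /orP[/eqP h0 | h0].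
  have : [set Some (x +i* y)%C]%classic (Some ((- 1 * x) +i* (- 1 * y))%C).
    rewrite -e; split; rewrite /circle_points /mkset /circle_form /normsq /=.
      by rewrite formE h0; ring.
    by rewrite discE; ring.
  by move=> [xE yE]; have : x = 0 /\ y = 0 by [lra|]; nra.
pose t := Num.max 0 (1 + h / 2).
have t0 : 0 <= t by rewrite le_max lexx.
have t1 : t < 1 by rewrite gt_max ltr01; lra.
have th : 1 - t < - h by rewrite /t; case: (leP 0 (1 + h / 2)) => ?; lra.
have [_ i] := T.
suff : (circle_interior (Circle KP) `&` circle_interior (Circle UP))%classic
  (Some ((- t * x) +i* (- t * y))%C) by rewrite i.
split; rewrite /circle_interior /mkset /circle_form /normsq /=.
  by rewrite formE pmulr_rlt0 // pmulr_rlt0; [nra | lra].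
by rewrite discE pmulr_rlt0 //; nra.
Qed.

(** For tangency points at angular distance theta the value is 1 - 2 h1 h2 sin^2 (theta / 2). The
    square suggests attaching to a petal a vector of length sqrt h at half its angle. *)
Lemma disc_petal_ip h1 z1 K1 h2 z2 K2 : disc_petal h1 z1 K1 -> disc_petal h2 z2 K2 ->
  ip K1 K2 = 1 - h1 * h2 * (1 - complex.Re (conjc z1 * z2)).
Proof.
case: K1 K2 z1 z2 => A1 [b1 b1'] D1 P1 [A2 [b2 b2'] D2 P2] [x1 y1] [x2 y2].
move=> [h10 n1 [nu1 nu10 [/= A1E [b1E b1'E] D1E]]] [h20 n2 [nu2 nu20 [/= A2E [b2E b2'E] D2E]]].
rewrite /normsq /= in n1 n2.
rewrite /ip /circle_prod !lorentz_diag /lorentz /normsq /=.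
have e1 : b1 ^+ 2 + b1' ^+ 2 - A1 * D1 = nu1 ^+ 2.
  transitivity ((nu1 * h1) ^+ 2 * (x1 ^+ 2 + y1 ^+ 2) - A1 * D1).
    by rewrite b1E b1'E; ring.
  by rewrite n1 A1E D1E; ring.
have e2 : b2 ^+ 2 + b2' ^+ 2 - A2 * D2 = nu2 ^+ 2.
  transitivity ((nu2 * h2) ^+ 2 * (x2 ^+ 2 + y2 ^+ 2) - A2 * D2).
    by rewrite b2E b2'E; ring.
  by rewrite n2 A2E D2E; ring.
rewrite e1 e2 -exprMn sqrtr_sqr gtr0_norm ?mulr_gt0 //.
rewrite b1E b1'E b2E b2'E A1E A2E D1E D2E.
by field; rewrite !gt_eqF.
Qed.

End UnitDisc.

(** * The vectors of an un-branched flower *)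

Section FlowerVectors.
Variable R : realType.

Definition det (a b : R * R) : R := a.1 * b.2 - a.2 * b.1.

(** The tangency angles are lifted to an increasing sequence that gains 2 pi per turn. Halving them
    turns a full turn into a change of sign and keeps differences within one turn between 0 and pi,
    where the sine is positive. *)
Lemma unbranched_vectors n (F : @flower R n) (v : nat -> R) :
    (3 < n)%N -> unbranched F -> is_u_label F v ->
  exists w : nat -> R * R,
    [/\ forall j k, (j < k < j + n)%N -> 0 < det (w j) (w k),
        forall k, w (k + n)%N = - w k,
        forall k, det (w k) (w k.+1) = 1 &
        forall k, det (w k) (w k.+2) = Num.sqrt 3 * v (k.+1 %% n)%N].
Proof.
move=> n3 [m [t [tau [delta [[um mC] Ht Hd Hsum]]]]] [Hlab vpos].
have n0 : (0 < n)%N by apply: leq_trans n3.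
pose o k : 'I_n := Ordinal (ltn_pmod k n0).
have oS k : ordS (o k) = o k.+1 by apply: val_inj; rewrite /= -addn1 modnDml addn1.
have oP k : ord_pred (o k.+1) = o k by rewrite -oS ordSK.
have oN k : o (k + n)%N = o k by apply: val_inj; rewrite /= modnDr.
pose T k : R := \sum_(i < k) delta (o i).
have TS k : T k.+1 = T k + delta (o k) by rewrite /T big_ord_recr.
have Tn : T n = 2 * pi.
  rewrite -Hsum; apply: eq_bigr => i _; congr delta; apply: val_inj.
  by rewrite /= modn_small.
have TN k : T (k + n)%N = T k + 2 * pi.
  elim: k => [|k IH]; first by rewrite add0n Tn /T big_ord0 add0r.
  by rewrite addSn !TS IH oN addrAC.
have Tlt j k : (j < k)%N -> T j < T k.
  elim: k => // k IH; rewrite ltnS leq_eqVlt => /orP[/eqP ->|/IH].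
    by rewrite TS ltrDl; have [/andP[]] := Hd (o k).
  by move/lt_trans; apply; rewrite TS ltrDl; have [/andP[]] := Hd (o k).
have umV : invmx m \in unitmx by rewrite unitmx_inv.
have U1 : is_unit_disc (pull umV (center F)).
  apply: interior_unit_disc; rewrite -mC; apply/seteqP; split=> p.
    by move/interior_pull => h; exists (mobius (invmx m) p); rewrite ?mobiusVK.
  by move=> [q Cq <-]; apply/interior_pull; rewrite mobiusK.
have /choice[h Hh] : forall j, exists h, disc_petal h (tau j) (pull umV (petal F j)).
  move=> j; have [tp mt] := Ht j.
  apply: (tangent_unit_disc U1).
    by apply: tangent_pull; apply: petal_center.
  by apply: tangency_point_pull; rewrite -mt mobiusK.
have tauE k : tau (o k) = tau (o 0%N) * (cos (T k) +i* sin (T k))%C.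
  elim: k => [|k IH].
    by rewrite /T big_ord0 cos0 sin0 -[LHS]mulr1; congr (_ * _).
  have [_] := Hd (o k); rewrite oS => ->; rewrite IH -mulrA TS cosD sinD.
  by congr (_ * _); apply/eqP; rewrite eq_complex /= addrC !eqxx /= addrC eqxx.
have tau_re j k : complex.Re (conjc (tau (o j)) * tau (o k)) = cos (T k - T j).
  have [_ z1 _] := Hh (o 0%N); rewrite (tauE j) (tauE k) cosB.
  move: z1; case: (tau (o 0%N)) => x y; rewrite /normsq /= => z1.
  transitivity ((x ^+ 2 + y ^+ 2) * (cos (T k) * cos (T j) + sin (T k) * sin (T j))).
    by ring.
  by rewrite z1 mul1r.
pose w k : R * R := (Num.sqrt (h (o k)) * cos (T k / 2), Num.sqrt (h (o k)) * sin (T k / 2)).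
have hpos j : 0 < h j by have [] := Hh j.
have detE j k : det (w j) (w k) = Num.sqrt (h (o j)) * Num.sqrt (h (o k)) * sin ((T k - T j) / 2).
  by rewrite /det /w /= mulrBl sinB; ring.
have det_pos j k : (j < k < j + n)%N -> 0 < det (w j) (w k).
  move=> /andP[jk kn]; rewrite detE !mulr_gt0 ?sqrtr_gt0 ?hpos //.
  apply: sin_gt0_pi; have := Tlt _ _ jk; have := Tlt _ _ kn; rewrite TN; lra.
have ipE j k : ip (petal F (o j)) (petal F (o k)) = 1 - 2 * det (w j) (w k) ^+ 2.
  rewrite -(ip_pull umV) (disc_petal_ip (Hh _) (Hh _)) tau_re detE.
  rewrite !exprMn !sqr_sqrtr ?(ltW (hpos _)) //.
  have -> : cos (T k - T j) = 1 - 2 * sin ((T k - T j) / 2) ^+ 2.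
    have {1}-> : T k - T j = ((T k - T j) / 2) *+ 2 by rewrite mulr2n; lra.
    by rewrite cos_mulr2n sin2cos2; ring.
  by ring.
(* Inversive products know determinants only up to sign; positivity within one turn removes the
   ambiguity. *)
have sq_inj (a b : R) : 0 < a -> 0 < b -> a ^+ 2 = b ^+ 2 -> a = b.
  by move=> a0 b0 /eqP; rewrite eqrXn2 ?ltW // => /eqP.
exists w; split=> //.
- move=> k; rewrite /w oN TN mulrDl [2 * pi]mulrC mulfK ?pnatr_eq0 //.
  by rewrite cosDpi sinDpi !mulrN.
- move=> k; apply: sq_inj => //; first by apply: det_pos; lia.
  have := ipE k k.+1; rewrite -oS (tangent_ip (petal_petal F _)); lra.
- move=> k; apply: sq_inj.
  + by apply: det_pos; lia.
  + by rewrite mulr_gt0 ?sqrtr_gt0 ?ltr0n // vpos ?ltn_pmod.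
  (* With s = 1 - u, equating 1 - 6 u^2 and 1 - 2 det^2 gives det = sqrt 3 u. *)
  have := intrinsic_schwarzian_ip (Hlab (o k.+1)).
  rewrite oP oS ipE exprMn sqr_sqrtr ?ler0n //= subKr; lra.
Qed.

End FlowerVectors.

(** * Continuants *)

Section Continuants.
Variable R : realType.
Implicit Types (x : nat -> R) (w : nat -> R * R).

(** The backward values 0 and 1 make one recursion cover the special clauses at 2 and 3 as well. *)
Lemma frakC_rec k x :
  frakC k.+2 x = Num.sqrt 3 * x k.+1 * frakC k.+1 x - frakC k x.
Proof.
case: k => [|[|k]] //=; first by rewrite mulr1 subr0.
by rewrite mulrACA -expr2 sqr_sqrtr ?ler0n // [x 2%N * _]mulrC mulrA.
Qed.

Lemma frakC_ind (P : nat -> Prop) :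
  P 0%N -> P 1%N -> (forall k, P k -> P k.+1 -> P k.+2) -> forall k, P k.
Proof.
move=> P0 P1 PS k; suff [] : P k /\ P k.+1 by [].
by elim: k => // k [? ?]; split=> //; apply: PS.
Qed.

Lemma eq_frakC j x y : (forall i, (1 <= i < j)%N -> x i = y i) ->
  frakC j x = frakC j y.
Proof.
elim/frakC_ind: j => // j IH0 IH1 e.
rewrite !frakC_rec e ?ltnSn // IH0 ?IH1 // => i ij; apply: e; lia.
Qed.

(** The formula for n = 4 is no exception, because [frakC 1] is 1. *)
Lemma frakUE n x :
  frakU n.+4 x = (1 + frakC n.+1 x) / (Num.sqrt 3 * frakC n.+2 x).
Proof.
case: n => [|n] //; rewrite /frakU /= mulrA -expr2 sqr_sqrtr ?ler0n //.
Qed.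

(** The three-term Plucker relation. When consecutive vectors have determinant 1, it yields both the
    continuant recursion and the formula for the missing labels. *)
Lemma det_plucker (a b c d : R * R) :
  det a d * det b c = det b d * det a c - det a b * det c d.
Proof. by rewrite /det; ring. Qed.

Lemma detNr (a b : R * R) : det a (- b) = det b a.
Proof. by case: a b => a a' [b b']; rewrite /det /=; ring. Qed.

Lemma frakC_det w k j x : (forall i, det (w i) (w i.+1) = 1) ->
  (forall i, (i.+1 < j)%N -> Num.sqrt 3 * x i.+1 = det (w (k + i)%N) (w (k + i).+2)) ->
  frakC j x = det (w k) (w (k + j)%N).
Proof.
move=> w1; elim/frakC_ind: j => [||j IH0 IH1] e.
- by rewrite addn0 /det /= mulrC subrr.
- by rewrite addn1 w1.
rewrite frakC_rec e // IH0 ?IH1 => [|i ij|i ij]; try by apply: e; lia.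
have := det_plucker (w k) (w (k + j)%N) (w (k + j).+1) (w (k + j).+2).
by rewrite !w1 !mulr1 !addnS.
Qed.

(** The relation applied to the vectors at k, k + n + 1, k + n + 2 and k + n + 3 reads sqrt 3 y
    C_{n+2} = 1 + C_{n+1}, once the outer determinant is known to be 1. *)
Lemma frakU_det w n k x y : (forall i, det (w i) (w i.+1) = 1) ->
  w (k + n.+4)%N = - w k -> 0 < det (w k) (w (k + n.+2)%N) ->
  (forall i, (i < n.+1)%N -> Num.sqrt 3 * x i.+1 = det (w (k + i)%N) (w (k + i).+2)) ->
  Num.sqrt 3 * y = det (w (k + n.+1)%N) (w (k + n.+3)%N) ->
  y = frakU n.+4 x.
Proof.
move=> w1 wN pos e ey; rewrite frakUE !(@frakC_det w k) // => [|i ij]; last first.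
  by apply: e; lia.
(* The next vector after w_{k+n+3} is - w_k, so this is a consecutive determinant in disguise. *)
have d1 : det (w k) (w (k + n.+3)%N) = 1.
  by have := w1 (k + n.+3)%N; rewrite -addnS wN detNr.
have := det_plucker (w k) (w (k + n.+1)%N) (w (k + n.+2)%N) (w (k + n.+3)%N).
rewrite -ey d1 !addnS !w1 !mulr1 -!addnS => e1.
have s3 : Num.sqrt 3 != 0 :> R by rewrite gt_eqF ?sqrtr_gt0 ?ltr0n.
apply: (mulIf (mulf_neq0 s3 (lt0r_neq0 pos))).
rewrite divfK ?mulf_neq0 ?lt0r_neq0 //; lra.
Qed.

Lemma unbranched_label n (u v : nat -> R) :
  (forall j, (1 <= j <= n.+1)%N -> v j = u j) ->
  (exists F : @flower R n.+4, unbranched F /\ is_u_label F v) ->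
  [/\ forall j, (2 <= j <= n.+2)%N -> 0 < frakC j u,
      v n.+2 = frakU n.+4 (fun i => v i),
      v n.+3 = frakU n.+4 (fun i => v (i + 1)%N) &
      v 0%N = frakU n.+4 (fun i => v (i + 2)%N)].
Proof.
move=> vu [F [FU Fv]].
have [w [wpos wN w1 w2]] := unbranched_vectors (isT : 3 < n.+4)%N FU Fv.
have pos k : 0 < det (w k) (w (k + n.+2)%N) by apply: wpos; lia.
split.
- move=> j jn; rewrite (@frakC_det w 0) // => [|i ij]; first by apply: wpos; lia.
  by rewrite w2 -vu ?modn_small ?add0n //; lia.
- apply: (frakU_det (k := 0) w1 (wN _) (pos _)) => [i ij|].
    by rewrite w2 modn_small ?add0n //; lia.
  by rewrite !add0n w2 modn_small.
- apply: (frakU_det (k := 1) w1 (wN _) (pos _)) => [i ij|].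
    by rewrite w2 modn_small ?add1n ?addn1 //; lia.
  by rewrite !add1n w2 modn_small.
(* The computed label has index n + 4, which wraps around to 0. *)
- apply: (frakU_det (k := 2) w1 (wN _) (pos _)) => [i ij|].
    by rewrite w2 modn_small ?add2n ?addn2 //; lia.
  by rewrite !add2n w2 modnn.
Qed.

End Continuants.

(** * Horocycles *)

Section Horocycles.
Variable R : realType.
Implicit Types (a b c w : R * R).

Lemma eq_circle (K L : @circle R) :
  coefA K = coefA L -> coefB K = coefB L -> coefD K = coefD L -> K = L.
Proof.
case: K L => A B D P [A1 B1 D1 Q] /= e1 e2 e3; subst.
by rewrite (bool_irrelevance P Q).
Qed.

Lemma lower_half_plane_subproof : 0 * 0 < normsq (0 -i* 1 : R[i])%C.
Proof. by rewrite /normsq /= mul0r expr0n sqrrN expr1n add0r ltr01. Qed.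

(** The centre of the constructed flower; its petals are then horocycles of the upper half plane, on
    which real matrices of determinant 1 act linearly through their vectors. *)
Definition lower_half_plane : circle := Circle lower_half_plane_subproof.

Lemma horo_subproof w :
  w.2 ^+ 2 * w.1 ^+ 2 < normsq ((- (w.1 * w.2)) +i* (1 / 2) : R[i])%C.
Proof. by rewrite /normsq /= sqrrN exprMn mulrC ltrDl exprn_gt0. Qed.

(* The circle in the upper half plane tangent to the real line at w.1 / w.2,
   of diameter 1 / w.2 ^ 2 (a Ford circle when w is a primitive integer vector). *)
Definition horo w : circle := Circle (horo_subproof w).

Lemma horoN w : horo (- w) = horo w.
Proof. by apply: eq_circle; rewrite /= ?sqrrN ?mulrNN. Qed.

Lemma horo_form w (z : R[i]) : circle_form (horo w) (Some z) =
  (w.2 * complex.Re z - w.1) ^+ 2 + w.2 ^+ 2 * complex.Im z ^+ 2 - complex.Im z.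
Proof. by case: z => x y; rewrite /circle_form /normsq /=; field. Qed.

Lemma half_plane_form (z : R[i]) :
  circle_form lower_half_plane (Some z) = 2 * complex.Im z.
Proof. by case: z => x y; rewrite /circle_form /normsq /=; ring. Qed.

Definition real_point w : @sphere R := point_of w.1%:C%C w.2%:C%C.

Lemma horo_tangency_point w : w != 0 ->
  tangency_point (horo w) lower_half_plane (real_point w).
Proof.
case: w => p q w0; rewrite /tangency_point /real_point /point_of /=.
have q0C : (q%:C%C == 0 :> R[i]) = (q == 0) by rewrite eq_complex /= eqxx andbT.
rewrite q0C; apply/seteqP; split=> [[z|]|_ ->].
- rewrite /circle_points /setI /mkset horo_form half_plane_form /= => -[h1 h2].
  have z0 : complex.Im z = 0 by lra.
  move: h1; rewrite z0 expr0n mulr0 addr0 subr0 => /eqP; rewrite sqrf_eq0 subr_eq0 => /eqP e.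
  case: eqVneq => [q0 | q0].
    by move: w0; rewrite -pair_eqE /pair_eq /= -e q0 mul0r eqxx.
  congr Some; case: z z0 e {h2} => x y /= -> <-.
  by rewrite rmorphM /= mulrAC divff ?q0C // mul1r.
- rewrite /circle_points /setI /mkset /= => -[/eqP]; rewrite sqrf_eq0 => -> //.
case: eqVneq => [q0 | q0].
  by rewrite /circle_points /setI /mkset /= q0 expr0n.
rewrite /circle_points /setI /mkset horo_form half_plane_form -fmorphV -rmorphM /=.
by rewrite mulrC divfK // subrr expr0n /= mulr0 addr0 subrr mulr0.
Qed.

Lemma horo_tangent_half_plane w : w != 0 -> tangent (horo w) lower_half_plane.
Proof.
move=> w0; split; first by exists (real_point w); apply: horo_tangency_point.
rewrite -subset0 => -[z|] []; rewrite /circle_interior /mkset; last by rewrite /= ltxx.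
rewrite horo_form half_plane_form => h1 h2; have z0 : complex.Im z < 0 by lra.
have := sqr_ge0 (w.2 * complex.Re z - w.1).
have : 0 <= w.2 ^+ 2 * complex.Im z ^+ 2 by rewrite mulr_ge0 ?sqr_ge0.
lra.
Qed.

Definition real_mx a b : 'M[R[i]]_2 := \matrix_(i < 2, j < 2)
  (if i == 0 then (if j == 0 then a.1%:C%C else b.1%:C%C)
   else (if j == 0 then a.2%:C%C else b.2%:C%C)).

Lemma real_mx_unit a b : det a b = 1 -> real_mx a b \in unitmx.
Proof.
move=> ab; rewrite unitmxE unitfE det2 !mxE /= -!rmorphM -rmorphB /=.
by rewrite [_ - _](_ : _ = 1) ?oner_eq0 // -ab /det; ring.
Qed.

Lemma proportional_takes (m : 'M[R[i]]_2) (um : m \in unitmx) K L :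
  proportional K (pull um L) -> takes_circle m K L.
Proof. by move=> h; apply/(takes_circleP um); apply: proportional_same. Qed.

Lemma real_mx_half_plane a b : det a b = 1 ->
  takes_circle (real_mx a b) lower_half_plane lower_half_plane.
Proof.
move=> ab; apply: (proportional_takes (um := real_mx_unit ab)); exists 1 => //.
move: a b ab => [p q] [p' q']; rewrite /det /= => ab.
rewrite /hform /pullB /normsq !mxE /=; split; try by ring.
apply/eqP; rewrite eq_complex /=; apply/andP; split; apply/eqP; first by ring.
by transitivity (- (p * q' - q * p')); [ring | rewrite ab; ring].
Qed.

(** Equivariance of [horo]: the matrix with columns a and b takes the vector w to w.1 a + w.2 b.
    Determinant 1 makes the scaling factor of the forms equal to 1. *)
Lemma real_mx_horo a b w : det a b = 1 ->
  takes_circle (real_mx a b) (horo w)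
    (horo (w.1 * a.1 + w.2 * b.1, w.1 * a.2 + w.2 * b.2)).
Proof.
move=> ab; apply: (proportional_takes (um := real_mx_unit ab)); exists 1 => //.
move: a b w ab => [p q] [p' q'] [x y]; rewrite /det /= => ab.
rewrite /hform /pullB /normsq !mxE /=; split.
- by transitivity ((y * (p * q' - q * p')) ^+ 2); [field | rewrite ab mulr1 mul1r].
- apply/eqP; rewrite eq_complex /=; apply/andP; split; apply/eqP.
    transitivity (- (x * y * (p * q' - q * p') ^+ 2)); first by field.
    by rewrite ab; field.
  transitivity ((p * q' - q * p') / 2); first by field.
  by rewrite ab; field.
- by transitivity ((x * (p * q' - q * p')) ^+ 2); [field | rewrite ab mulr1 mul1r].
Qed.

Lemma horo_tangent a b : det a b = 1 -> tangent (horo a) (horo b).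
Proof.
(* The inverse of the matrix with columns a and b reduces to the vectors (1, 0) and (0, 1), whose
   circles are the line Im z = 1 and the circle of diameter 1 above 0; these touch at i. *)
move=> ab; have ab' : det (b.2, - a.2) (- b.1, a.1) = 1 by rewrite -ab /det /=; ring.
apply: (takes_tangent (real_mx_unit ab') (real_mx_horo a ab') (real_mx_horo b ab')).
have -> : (a.1 * b.2 + a.2 * - b.1, a.1 * - a.2 + a.2 * a.1) = (1, 0).
  by congr pair; rewrite -?ab /det; ring.
have -> : (b.1 * b.2 + b.2 * - b.1, b.1 * - a.2 + b.2 * a.1) = (0, 1).
  by congr pair; rewrite -?ab /det; ring.
split.
  exists (Some 'i%C); apply/seteqP; split=> [[[x y]|]|_ ->].
  - rewrite /circle_points /setI /mkset !horo_form /= => -[h1 h2].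
    have y1 : y = 1 by lra.
    have x0 : x ^+ 2 = 0 by move: h2; rewrite y1; lra.
    by congr (Some (Complex _ _)) => //; apply/eqP; rewrite -sqrf_eq0 x0.
  - by rewrite /circle_points /setI /mkset /= => -[_ /eqP]; rewrite expr1n oner_eq0.
  - by rewrite /circle_points /setI /mkset !horo_form /=; split; ring.
rewrite -subset0 => -[[x y]|] []; rewrite /circle_interior /mkset; last first.
  by rewrite /= expr0n ltxx.
rewrite !horo_form /= => h1 h2; have y1 : 1 < y by lra.
have : 0 < y * (y - 1) by rewrite mulr_gt0 //; lra.
have := sqr_ge0 x; lra.
Qed.

(* z |-> sqrt 3 / (z - 1) + i / 2 takes the base patch to horocycles. *)
Definition base_mx : 'M[R[i]]_2 := \matrix_(i < 2, j < 2)
  (if i == 0 then (if j == 0 then 'i%C else ((2 * Num.sqrt 3) -i* 1)%C)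
   else (if j == 0 then 2 else - 2)).

Lemma base_mx_unit : base_mx \in unitmx.
Proof.
rewrite unitmxE unitfE det2 !mxE /= eq_complex /= negb_and.
apply/orP; left; rewrite lt_eqF //.
Qed.

Lemma base_mx_takes :
  [/\ takes_circle base_mx base_v (horo (1, 0)),
      takes_circle base_mx base_w lower_half_plane,
      takes_circle base_mx base_a (horo (Num.sqrt 3 / 2, -1)) &
      takes_circle base_mx base_b (horo (Num.sqrt 3 / 2, 1))].
Proof.
have s2 : Num.sqrt 3 ^+ 2 = 3 :> R by rewrite sqr_sqrtr ?ler0n.
split; apply: (proportional_takes (um := base_mx_unit));
  (* The self-products force these factors: 3 for base circles, 1/4 for horocycles, 1 for the half
     plane, and 48 for the squared modulus of the determinant of [base_mx]. *)
  [exists 2 | exists 4 | exists 2 | exists 2] => //.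
all: rewrite /pull /=.
all: rewrite /hform /pullB /normsq ?mxE /=; move: (Num.sqrt 3) s2 => s s2; split.
all: try (apply/eqP; rewrite eq_complex /=; apply/andP; split; apply/eqP).
all: try lra.
all: try nra.
Qed.

End Horocycles.

(** * Schwarzians and winding of horocycle flowers *)

Section HorocycleFlowers.
Variable R : realType.
Implicit Types (a b c : R * R) (K L M : @circle R) (x : nat -> R).

Lemma takes_circle_mul (m1 m2 : 'M[R[i]]_2) K L M : m1 \in unitmx ->
  takes_circle m1 K L -> takes_circle m2 L M -> takes_circle (m2 *m m1) K M.
Proof.
move=> u1 [p1 i1] [p2 i2]; rewrite /takes_circle -p2 -i2 -p1 -i1.
by split; apply/seteqP; split=> p;
  [ move=> [q Kq <-]; exists (mobius m1 q); [exists q | rewrite mobius_mul]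
  | move=> [_ [q Kq <-] <-]; exists q; rewrite ?mobius_mul
  | move=> [q Kq <-]; exists (mobius m1 q); [exists q | rewrite mobius_mul]
  | move=> [_ [q Kq <-] <-]; exists q; rewrite ?mobius_mul].
Qed.

Lemma eq_mx2 (A B : 'M[R[i]]_2) : A 0 0 = B 0 0 -> A 0 1 = B 0 1 ->
  A 1 0 = B 1 0 -> A 1 1 = B 1 1 -> A = B.
Proof.
move=> e00 e01 e10 e11; apply/matrixP => i j.
have split2 (k : 'I_2) : k = 0 \/ k = 1.
  by case: k => [[|[|k]] kP] //; [left | right]; apply: val_inj.
by case: (split2 i) => ->; case: (split2 j) => ->.
Qed.

Lemma det_neq0 a b : det a b = 1 -> a != 0.
Proof.
move=> ab; apply/eqP => a0; move/eqP: ab; rewrite a0 /det /= !mul0r subrr.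
by rewrite eq_sym oner_eq0.
Qed.

Lemma mulmx2E (A B : 'M[R[i]]_2) i j : (A *m B) i j = A i 0 * B 0 j + A i 1 * B 1 j.
Proof.
rewrite mxE !big_ord_recl big_ord0 addr0.
by rewrite (_ : lift ord0 ord0 = 1) //; apply: val_inj.
Qed.

Lemma horo_schwarzian a b c (u : R) : det a b = 1 -> det b c = 1 ->
  a.1 + c.1 = Num.sqrt 3 * u * b.1 -> a.2 + c.2 = Num.sqrt 3 * u * b.2 ->
  intrinsic_schwarzian (horo b) (lower_half_plane R) (horo a) (horo c) (1 - u).
Proof.
move=> ab bc e1 e2.
have a0 := det_neq0 ab; have b0 := det_neq0 bc.
have c0 : c != 0 by apply: (@det_neq0 c (- b)); rewrite detNr.
split.
  split; split; try exact: horo_tangent_half_plane.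
  - by apply/tangent_sym/horo_tangent_half_plane.
  - by apply/tangent_sym/horo_tangent.
  - by apply/tangent_sym/horo_tangent_half_plane.
  - exact: horo_tangent.
set r := Num.sqrt 3 in e1 e2.
(* Chosen so that (1, 0) goes to b under both matrices, (r / 2, -1) goes to a under the first and (r
   / 2, 1) to c under the second. *)
pose a' := (r / 2 * b.1 - a.1, r / 2 * b.2 - a.2).
pose c' := (c.1 - r / 2 * b.1, c.2 - r / 2 * b.2).
have ba' : det b a' = 1 by rewrite -ab /det /a' /=; ring.
have bc' : det b c' = 1 by rewrite -bc /det /c' /=; ring.
have [tv tw ta tb] := base_mx_takes R.
have u0 := base_mx_unit R.
have uf := real_mx_unit ba'; have ug := real_mx_unit bc'.
exists (real_mx b a' *m base_mx R), (real_mx b c' *m base_mx R); split.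
- split; first by rewrite unitmx_mul uf u0.
  split.
  + apply: takes_circle_mul u0 tv _; have := real_mx_horo (1, 0) ba'.
    by rewrite /= !mul1r !mul0r !addr0 -surjective_pairing.
  + exact: takes_circle_mul u0 tw (real_mx_half_plane ba').
  + apply: takes_circle_mul u0 ta _; have := real_mx_horo (r / 2, -1) ba'.
    by rewrite /= !mulN1r !opprB !addrA ![r / 2 * _ + _]addrC !addrK -surjective_pairing.
- split; first by rewrite unitmx_mul ug u0.
  split.
  + apply: takes_circle_mul u0 tv _; have := real_mx_horo (1, 0) bc'.
    by rewrite /= !mul1r !mul0r !addr0 -surjective_pairing.
  + exact: takes_circle_mul u0 tw (real_mx_half_plane bc').
  + apply: takes_circle_mul u0 tb _; have := real_mx_horo (r / 2, 1) bc'.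
    by rewrite /= !mul1r ![r / 2 * _ + _]addrC !subrK -surjective_pairing.
exists 1; first exact: oner_neq0.
(* Here a' = c' + r (1 - u) b, so the two real matrices differ by a translation of the upper half
   plane. [base_mx] sends 1 to infinity and conjugates this translation to the schwarzian matrix,
   which fixes 1. *)
rewrite scale1r; apply: (canLR (mulKmx _)); first by rewrite unitmx_mul ug u0.
have a1E : a.1 = r * u * b.1 - c.1 by rewrite -e1 addrK.
have a2E : a.2 = r * u * b.2 - c.2 by rewrite -e2 addrK.
by apply: eq_mx2; rewrite !mulmx2E !mxE /= ?a1E ?a2E -/r;
  apply/eqP; rewrite eq_complex /=; apply/andP; split; apply/eqP; field.
Qed.

(** The map (z + i) / (z - i), from the lower half plane to the unit disc. *)
Definition cayley : 'M[R[i]]_2 := \matrix_(i < 2, j < 2)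
  (if j == 0 then 1 else if i == 0 then 'i%C else - 'i%C).

Lemma cayley_unit : cayley \in unitmx.
Proof.
rewrite unitmxE unitfE det2 !mxE /= eq_complex /= negb_and.
by apply/orP; right; rewrite lt_eqF //; lra.
Qed.

Lemma cayley_interior :
  (mobius cayley @` circle_interior (lower_half_plane R) =
  [set p | exists2 z, p = Some z & normsq z < 1])%classic.
Proof.
have [_ ->] : takes_circle cayley (lower_half_plane R) (round_circle 0 ltr01).
  apply: (proportional_takes (um := cayley_unit)); exists 2 => //.
  rewrite /pull /=; rewrite /hform /pullB /normsq ?mxE /=; split; try by ring.
  by apply/eqP; rewrite eq_complex /=; apply/andP; split; apply/eqP; ring.
rewrite interior_round_circle; apply/seteqP.
by split=> p [z -> h]; exists z => //; move: h; rewrite subr0 expr1n.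
Qed.

(** With a = (p, q), this is (p + i q)^2 / |p + i q|^2: the direction of the vector with its angle
    doubled. *)
Definition cayley_point a : R[i] :=
  ((a.1 ^+ 2 - a.2 ^+ 2) / (a.1 ^+ 2 + a.2 ^+ 2) +i*
   (2 * a.1 * a.2 / (a.1 ^+ 2 + a.2 ^+ 2)))%C.

Lemma cayley_pointN a : cayley_point (- a) = cayley_point a.
Proof. by rewrite /cayley_point /= !sqrrN !(mulrN, mulNr) opprK. Qed.

Lemma normsq_pair_gt0 a : a != 0 -> 0 < a.1 ^+ 2 + a.2 ^+ 2.
Proof.
case: a => p q a0; rewrite lt0r addr_ge0 ?sqr_ge0 // andbT /=.
rewrite paddr_eq0 ?sqr_ge0 // !sqrf_eq0.
by apply: contra a0 => /andP[/eqP -> /eqP ->].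
Qed.

Lemma mobius_cayley a : a != 0 -> mobius cayley (real_point a) = Some (cayley_point a).
Proof.
move=> a0; have s0 := normsq_pair_gt0 a0; case: a a0 s0 => p q a0 /= s0.
rewrite /real_point mobius_point_of; last first.
  rewrite !eq_complex /= !eqxx !andbT -negb_and.
  by apply: contra a0 => /andP[/eqP -> /eqP ->].
rewrite /point_of !mxE /=.
have d0 : (1 * p%:C%C + - 'i%C * q%:C%C : R[i]) != 0.
  rewrite eq_complex /= !(mul1r, mul0r, mulr0, subr0, addr0, oppr0, add0r, mulN1r, oppr_eq0).
  by apply: contra a0 => /andP[/eqP -> /eqP ->].
rewrite (negbTE d0); congr Some; apply: (mulIf d0); rewrite divfK //.
have s1 := lt0r_neq0 s0.
by apply/eqP; rewrite eq_complex /=; apply/andP; split; apply/eqP; field.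
Qed.

(** Since [acos] takes values in [0, pi], this is the polar angle only for vectors with nonnegative
    second coordinate. *)
Definition angle a : R := acos (a.1 / Num.sqrt (a.1 ^+ 2 + a.2 ^+ 2)).

Lemma angleP a : a != 0 -> 0 <= a.2 -> exists2 r, 0 < r &
  [/\ a.1 = r * cos (angle a), a.2 = r * sin (angle a) & 0 <= angle a <= pi].
Proof.
move=> /normsq_pair_gt0 s0 a2; rewrite /angle; set r := Num.sqrt _.
have r0 : 0 < r by rewrite sqrtr_gt0.
have r2 : r ^+ 2 = a.1 ^+ 2 + a.2 ^+ 2 by rewrite sqr_sqrtr ?ltW.
have sq1 : (a.1 / r) ^+ 2 + (a.2 / r) ^+ 2 = 1.
  by rewrite !expr_div_n -mulrDl -r2 divff // expf_neq0 ?gt_eqF.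
have le1 : -1 <= a.1 / r <= 1.
  rewrite -ler_norml -(@ler_pXn2r _ 2) ?nnegrE ?normr_ge0 ?ler01 //.
  by rewrite expr1n real_normK ?num_real // -sq1 lerDl sqr_ge0.
exists r => //; split; last by rewrite acos_ge0 ?acos_lepi.
  by rewrite acosK ?in_itv //= mulrC divfK ?gt_eqF.
rewrite sin_acos // -[X in X - _]sq1 addrAC subrr add0r sqrtr_sqr.
rewrite ger0_norm; last by rewrite divr_ge0 // ltW.
by rewrite mulrC divfK ?gt_eqF.
Qed.

Lemma cayley_point_angle a : a != 0 -> 0 <= a.2 ->
  cayley_point a = (cos (2 * angle a) +i* sin (2 * angle a))%C.
Proof.
move=> a0 a2; have [r r0 [e1 e2 _]] := angleP a0 a2.
have -> : 2 * angle a = angle a + angle a by ring.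
have cs := cos2Dsin2 (angle a).
rewrite /cayley_point cosD sinD {}e1 {}e2.
move: (cos _) (sin _) cs => C S cs.
have -> : (r * C) ^+ 2 + (r * S) ^+ 2 = r ^+ 2 by rewrite !exprMn -mulrDr cs mulr1.
by congr (Complex _ _); field; rewrite gt_eqF.
Qed.

Lemma angle_lt a b : det a b = 1 -> 0 <= a.2 -> 0 <= b.2 ->
  0 < angle b - angle a < pi.
Proof.
move=> ab a2 b2; have a0 := det_neq0 ab.
have b0 : b != 0 by apply: (@det_neq0 b (- a)); rewrite detNr.
have [r r0 [e1 e2 /andP[ta0 ta1]]] := angleP a0 a2.
have [s s0 [f1 f2 /andP[tb0 tb1]]] := angleP b0 b2.
have e : r * s * sin (angle b - angle a) = 1.
  by rewrite -ab sinB /det e1 e2 f1 f2; ring.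
have sin0 : 0 < sin (angle b - angle a).
  by rewrite -(pmulr_rgt0 _ (mulr_gt0 r0 s0)) e ltr01.
apply/andP; split; rewrite ltNge; apply/negP => h.
  have : 0 <= sin (angle a - angle b) by apply: sin_ge0_pi; apply/andP; split; lra.
  by rewrite -opprB sinN oppr_ge0 leNgt sin0.
have eq_pi : angle b - angle a = pi by lra.
by move: sin0; rewrite eq_pi sinpi ltxx.
Qed.

(** The vectors turn counterclockwise from (1, 0) to (-1, 0) within the closed upper half plane, so
    their angles climb from 0 to pi. The arcs are twice the angle increments and telescope to 2
    pi. *)
Lemma horo_unbranched n (F : @flower R n.+1) (w : nat -> R * R) :
  center F = lower_half_plane R -> (forall j, petal F j = horo (w j)) ->
  (forall k, det (w k) (w k.+1) = 1) -> w 0%N = (1, 0) -> w n.+1 = - w 0%N ->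
  (forall k, (k <= n.+1)%N -> 0 <= (w k).2) -> unbranched F.
Proof.
move=> FC FP w1 w0 wn wpos.
have wneq k : w k != 0 by apply: det_neq0 (w1 k).
exists cayley, (fun j => real_point (w j)), (fun j => cayley_point (w j)),
  (fun j => 2 * (angle (w j.+1) - angle (w j))); split.
- by split; [exact: cayley_unit | rewrite FC cayley_interior].
- by move=> j; rewrite FC FP mobius_cayley //; split=> //; apply: horo_tangency_point.
- move=> j; have jn : (j < n.+1)%N by [].
  have /andP[d0 dpi] := angle_lt (w1 j) (wpos _ (ltnW jn)) (wpos _ jn).
  split; first by apply/andP; split; lra.
  (* The successor of the last index is 0, while the angle increment uses [w n.+1]; these vectors
     are opposite and give the same point. *)
  have -> : cayley_point (w (ordS j)) = cayley_point (w j.+1).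
    rewrite /=; move: jn; rewrite leq_eqVlt => /orP[/eqP e | jn].
      by rewrite e modnn wn cayley_pointN.
    by rewrite modn_small.
  rewrite !cayley_point_angle ?wpos //; last exact: ltnW.
  have -> : 2 * angle (w j.+1) = 2 * angle (w j) + 2 * (angle (w j.+1) - angle (w j)) by ring.
  by rewrite cosD sinD; apply/eqP; rewrite eq_complex /= eqxx addrC eqxx.
rewrite -(big_mkord xpredT (fun j => 2 * (angle (w j.+1) - angle (w j)))).
rewrite -mulr_sumr telescope_sumr // wn w0 /angle /=.
by rewrite oppr0 sqrrN expr1n expr0n /= addr0 sqrtr1 !divr1 acosN1 acos1 subr0.
Qed.

End HorocycleFlowers.

(** * Rebuilding the flower from its labels *)

Section Construction.
Variable R : realType.
Implicit Types x u v : nat -> R.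

(* The solution of w_{k+2} = sqrt 3 x_{k+1} w_{k+1} - w_k starting from the
   standard basis. *)
Definition petal_vec x j : R * R :=
  (if j is k.+1 then - frakC k (fun i => x i.+1) else 1, frakC j x).

Lemma petal_vec_rec x k :
  petal_vec x k.+2 =
    (Num.sqrt 3 * x k.+1 * (petal_vec x k.+1).1 - (petal_vec x k).1,
     Num.sqrt 3 * x k.+1 * (petal_vec x k.+1).2 - (petal_vec x k).2).
Proof.
rewrite /petal_vec [in LHS]frakC_rec; congr pair.
by case: k => [|k]; rewrite ?frakC_rec /=; ring.
Qed.

Lemma petal_vec_det x k : det (petal_vec x k) (petal_vec x k.+1) = 1.
Proof.
elim: k => [|k IH]; first by rewrite /det /=; ring.
by rewrite petal_vec_rec -IH /det /=; ring.
Qed.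

Lemma flower_of_vectors n v (w := petal_vec (fun k => v (k %% n.+3)%N)) :
  (forall j, (j < n.+3)%N -> 0 < v j) ->
  (forall k, w (k + n.+3)%N = - w k) ->
  (forall k, (k <= n.+3)%N -> 0 <= (w k).2) ->
  exists F : @flower R n.+3, unbranched F /\ is_u_label F v.
Proof.
move=> vpos wN wpos.
have w1 k : det (w k) (w k.+1) = 1 by apply: petal_vec_det.
have horo_mod k : horo (w (k %% n.+3)%N) = horo (w k).
  rewrite {2}(divn_eq k n.+3); elim: (k %/ n.+3)%N => [|q IH] //.
  by rewrite mulSn -addnA [(n.+3 + _)%N]addnC wN horoN.
have pc (j : 'I_n.+3) : tangent (horo (w j)) (lower_half_plane R).
  by apply: horo_tangent_half_plane; apply: det_neq0 (w1 _).
have pp (j : 'I_n.+3) : tangent (horo (w j)) (horo (w (ordS j))).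
  by rewrite horo_mod; apply: horo_tangent.
exists (Flower (isT : 2 < n.+3)%N pc pp); split.
  by apply: (@horo_unbranched _ _ _ w) => //; rewrite -[n.+3]add0n wN.
split=> // j; rewrite /= !horo_mod.
(* Shifting the indices by a full turn provides a predecessor even for j = 0; the two sign changes
   leave the horocycles unchanged. *)
have [k kE] : exists k, (j + n.+3)%N = k.+1 by exists (j + n.+2)%N; rewrite addnS.
rewrite kE /= -[horo (w j)]horoN -wN kE -[horo (w j.+1)]horoN -wN addSn kE.
have vE : v (k.+1 %% n.+3)%N = v j by rewrite -kE modnDr modn_small.
have wE : w k.+2 = _ := petal_vec_rec _ k.
by apply: horo_schwarzian; rewrite ?w1 // wE -vE addrC subrK.
Qed.

(** The three free labels are chosen to close up the vectors with a change of sign. The continuant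
    conditions keep the vectors in the upper half plane and make the new labels positive. *)
Lemma unbranched_flower_exists n u : (forall j, (1 <= j <= n.+1)%N -> 0 < u j) ->
  (forall j, (2 <= j <= n.+2)%N -> 0 < frakC j u) ->
  exists v, (forall j, (1 <= j <= n.+1)%N -> v j = u j) /\
    exists F : @flower R n.+4, unbranched F /\ is_u_label F v.
Proof.
move=> upos Cpos.
have s3 : 0 < Num.sqrt 3 :> R by rewrite sqrtr_gt0 ltr0n.
have s3n := lt0r_neq0 s3.
have C1 : 0 < frakC n.+1 u by case: n {upos} Cpos => [|n] Cpos; [exact: ltr01 | apply: Cpos; lia].
have C2 : 0 < frakC n.+2 u by apply: Cpos; lia.
pose v1 i := if i == n.+2 then frakU n.+4 u else u i.
(* Writing w_k = (x_k, y_k), label n + 2 is set to give y_{n+3} = 1, label n + 3 to give y_{n+4} =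
   0, and label 0 to give x_{n+5} = 0. *)
pose v i := if i == 0%N then frakC n.+2 (fun i => v1 i.+1) / Num.sqrt 3
            else if i == n.+3 then frakC n.+2 u / Num.sqrt 3 else v1 i.
pose X k := v (k %% n.+4)%N; pose w := petal_vec X.
have Xv k : (k < n.+4)%N -> X k = v k by move=> kn; rewrite /X modn_small.
have vu j : (1 <= j <= n.+1)%N -> v j = u j.
  by move=> jn; rewrite /v /v1; do 3 (case: eqP => [?|_]; first lia).
have yu j : (j <= n.+2)%N -> frakC j X = frakC j u.
  by move=> jn; apply: eq_frakC => i ij; rewrite Xv ?vu //; lia.
have X2 : Num.sqrt 3 * X n.+2 * frakC n.+2 u = 1 + frakC n.+1 u.
  have -> : X n.+2 = frakU n.+4 u by rewrite Xv // /v /v1 eqxx (ltn_eqF (ltnSn n.+2)).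
  by rewrite frakUE; field; rewrite s3n lt0r_neq0.
have X3 : Num.sqrt 3 * X n.+3 = frakC n.+2 u.
  by rewrite Xv // /v eqxx mulrC divfK.
have X4 : Num.sqrt 3 * X n.+4 = - (w n.+3).1.
  rewrite /X modnn /v eqxx mulrC divfK // opprK; apply: eq_frakC => i ij.
  by rewrite Xv ?ltnS; [rewrite /v; do 2 (case: eqP => [?|_]; first lia) | lia].
have y k : (w k).2 = frakC k X by [].
have y3 : (w n.+3).2 = 1.
  by rewrite y frakC_rec !yu // X2 addrK.
have y4 : (w n.+4).2 = 0.
  by rewrite y frakC_rec -y y3 mulr1 X3 yu // subrr.
have x4 : (w n.+4).1 = -1.
  by have := petal_vec_det X n.+3; rewrite -/w /det y3 y4 mulr0 mul1r sub0r => <-; rewrite opprK.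
(* The labels are periodic and the recursion has order two, so it suffices to check two consecutive
   vectors. *)
have wN k : w (k + n.+4)%N = - w k.
  elim/frakC_ind: k => [||k IH0 IH1].
  - by rewrite add0n [LHS]surjective_pairing x4 y4 /w /petal_vec /=; congr pair; rewrite oppr0.
  - rewrite add1n /w petal_vec_rec -/w X4 x4 y4 y3.
    by congr pair; rewrite /=; ring.
  rewrite !addSn /w !petal_vec_rec -/w -!addSn IH0 IH1.
  have -> : X (k.+1 + n.+4)%N = X k.+1 by rewrite /X modnDr.
  by congr pair; rewrite /=; ring.
have ypos j : (1 <= j <= n.+3)%N -> 0 < (w j).2.
  move=> jn; have [j3 | ] := eqVneq j n.+3; first by rewrite j3 y3 ltr01.
  move=> j3; rewrite y yu; last by lia.
  have [-> | j1] := eqVneq j 1%N; first exact: ltr01.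
  by apply: Cpos; lia.
(* Determinant 1 gives y_{j+2} x_{j+3} = x_{j+2} y_{j+3} - 1, which propagates the negative sign;
   label 0 is positive because it equals - x_{n+3} / sqrt 3. *)
have xneg j : (j <= n.+1)%N -> (w j.+2).1 < 0.
  elim: j => [|j IH] jn; first by rewrite /= oppr_lt0 ltr01.
  have := petal_vec_det X j.+2; rewrite -/w /det => e.
  have y2 : 0 < (w j.+2).2 by apply: ypos; lia.
  have ? : (w j.+2).1 * (w j.+3).2 < 0 by rewrite nmulr_rlt0 ?ypos ?IH //; lia.
  by rewrite -(pmulr_rlt0 _ y2); lra.
exists v; split=> //; apply: flower_of_vectors => //; last first.
  move=> [|k] kn; first exact: lexx.
  have [-> | k4] := eqVneq k n.+3; first by rewrite -/X -/w y4.
  by apply/ltW/ypos; lia.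
move=> j jn; have [-> | j0] := eqVneq j 0%N.
  have -> : v 0%N = X n.+4 by rewrite /X modnn.
  by rewrite -(pmulr_rgt0 _ s3) X4 oppr_gt0 xneg.
have [-> | j3] := eqVneq j n.+3.
  by rewrite -Xv // -(pmulr_rgt0 _ s3) X3.
have [-> | j2] := eqVneq j n.+2.
  rewrite -Xv // -(pmulr_rgt0 _ s3) -(pmulr_lgt0 _ C2) X2 addr_gt0 //.
by rewrite vu ?upos //; lia.
Qed.

End Construction.

Unset Implicit Arguments.


Theorem theorem4p5 (R : realType) (n : nat) (u : nat -> R)
    (hn : (3 < n)%N)
    (hu : forall j, (1 <= j <= n - 3)%N -> 0 < u j) :
  ((exists v : nat -> R,
      (forall j, (1 <= j <= n - 3)%N -> v j = u j) /\
      exists F : @flower R n, unbranched F /\ is_u_label F v)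
   <->
   (forall j, (2 <= j <= n - 2)%N -> 0 < frakC j u))
  /\
  (forall v : nat -> R,
     (forall j, (1 <= j <= n - 3)%N -> v j = u j) ->
     (exists F : @flower R n, unbranched F /\ is_u_label F v) ->
     [/\ v (n - 2)%N = frakU n (fun i => v i),
         v (n - 1)%N = frakU n (fun i => v (i + 1)%N) &
         v 0%N = frakU n (fun i => v (i + 2)%N)]).
Proof.
case: n hn hu => [|[|[|[|n]]]] // _ hu; rewrite !subSS !subn0 in hu *.
split; last by move=> v vu F; have [] := unbranched_label vu F.
split; first by move=> [v [vu F]]; have [] := unbranched_label vu F.
exact: unbranched_flower_exists.
Qed.
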